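(* Consider the facility location problem on a random shortest path metric on $n$ vertices with opening costs $0<f_1\le f_2\le\dots\le f_n$ (which may depend on $n$), and assume there is a constant $q$ with $f_n/f_1\le n^q$ for all $n$. Define $\kappa:=\kappa(n;f_1,\ldots,f_n)=\max\{i\in[n]: f_i<1/(i-1)\}$ and assume that $\kappa\in o(n)$. Let $\mathsf{ALG}$ denote the total cost of the solution which opens, independently of the metric, the $\kappa$ cheapest facilities (i.e. the facilities with opening costs $f_1,\ldots,f_\kappa$), and let $\mathsf{OPT}$ be the optimal cost. Then $$\mathbb{E}\left[\frac{\mathsf{ALG}}{\mathsf{OPT}}\right]=1+o(1)\quad\text{as } n\to\infty.$$
   Context: Random shortest path metric: let $G=(V,E)$ be the complete undirected graph on $n$ vertices; each edge $e$ independently receives a weight $w(e)\sim\mathrm{Exp}(1)$ (exponential distribution with rate $1$), and $d(u,v)$ is the minimum total weight of a $u$-$v$ path in $G$. Facility location: vertex $i\in V=[n]$ has opening cost $f_i>0$, the costs are deterministic (independent of the edge weights) and numbered so that $f_1\le\dots\le f_n$. For nonempty $U\subseteq V$, $c(U)=\sum_{i\in U}f_i+\sum_{v\in V}\min_{u\in U}d(u,v)$, and $\mathsf{OPT}=\min_{\emptyset\ne U\subseteq V}c(U)$. In the definition of $\kappa$, $1/(i-1)$ for $i=1$ is interpreted as $+\infty$, so $\kappa\ge1$. $\mathsf{ALG}=c(\{1,\ldots,\kappa\})$. Asymptotic notation refers to $n\to\infty$, where the opening costs are allowed to depend on $n$. *)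

(* Defs.v *)
From HB Require Import structures.
From mathcomp Require Import all_boot all_order all_algebra.
From mathcomp Require Import all_classical all_reals all_analysis.
Set Implicit Arguments. Unset Strict Implicit. Unset Printing Implicit Defensive.
Import Order.TTheory GRing.Theory Num.Theory.
Local Open Scope classical_set_scope.
Local Open Scope ring_scope.

(* Vertices of the complete graph K_n are 'I_n; vertex k (0-based)
   corresponds to the paper's vertex k+1.  Undirected edges {u,v}, u<>v,
   are represented by pairs (u,v) with u < v. *)
Definition is_edge (n : nat) (e : 'I_n * 'I_n) : bool := (e.1 < e.2)%N.

Section Metric.
Context {R : realType} {n : nat}.

Definition wt (w : 'I_n * 'I_n -> R) (u v : 'I_n) : R :=
  if (u < v)%N then w (u, v) else w (v, u).

(* total weight of the path u = x_0, x_1, ..., x_k given by p = [x_1;...;x_k] *)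
Definition path_weight (w : 'I_n * 'I_n -> R) (u : 'I_n) (p : seq 'I_n) : R :=
  \sum_(x <- pairmap (wt w) u p) x.

Definition is_path (u v : 'I_n) (p : seq 'I_n) : bool :=
  uniq (u :: p) && (last u p == v).

Definition dist (w : 'I_n * 'I_n -> R) (u v : 'I_n) : R :=
  inf [set path_weight w u p | p in [set p | is_path u v p]].

Definition flcost (f : 'I_n -> R) (w : 'I_n * 'I_n -> R) (U : {set 'I_n}) : R :=
  \sum_(i in U) f i + \sum_(v : 'I_n) inf [set dist w u v | u in [set u | u \in U]].

Definition OPT (f : 'I_n -> R) (w : 'I_n * 'I_n -> R) : R :=
  inf [set flcost f w U | U in [set U : {set 'I_n} | (0 < #|U|)%N]].

(* kappa = max { i in [n] : f_i < 1/(i-1) } (paper's 1-based indexing, with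
   1/(1-1) = +oo); here i = k+1 for the 0-based index k. *)
Definition kappa (f : 'I_n -> R) : nat :=
  \max_(k < n | (nat_of_ord k == 0)%N || (f k < (k%:R)^-1)) k.+1.

Definition ALG (f : 'I_n -> R) (w : 'I_n * 'I_n -> R) : R :=
  flcost f w [set k : 'I_n | (k < kappa f)%N].

End Metric.

Definition iid_exp1 {R : realType} (n : nat) d (T : measurableType d)
    (P : probability T R) (X : 'I_n * 'I_n -> {RV P >-> R}) : Prop :=
  (forall e, is_edge e -> forall B : set R, measurable B ->
      P (X e @^-1` B) = exponential_prob 1 B)
  /\ (forall (S : {set 'I_n * 'I_n}) (B : 'I_n * 'I_n -> set R),
      (forall e, e \in S -> is_edge e) -> (forall e, measurable (B e)) ->
      P [set x | forall e, e \in S -> B e (X e x)]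
      = (\prod_(e in S) P (X e @^-1` B e))%E).

(* Main.v *)
Require Import Defs.
From HB Require Import structures.
From mathcomp Require Import all_boot all_order all_algebra.
From mathcomp Require Import all_classical all_reals all_analysis.
From mathcomp Require Import measurable_realfun ring lra zify.
Import Order.TTheory GRing.Theory Num.Theory.
Local Open Scope classical_set_scope.
Local Open Scope ring_scope.

(** Write C_U for the connection cost of U, k = #|U|, and n/kappa = exp l. All
    k(n-k) edges leaving U exceed h with probability exp(-k(n-k)h), and by
    memorylessness conditioning on this adds h to each of them, which raises
    C_U by exactly (n-k)h; otherwise some edge uv
    leaving U is at most h, and then C_U is within (n-k)h of the cost of
    v |: U, which does not depend on the weight of uv. Letting h tend to 0, the
    union bound over the leaving edges is sharp enough to give
    E exp(-theta C_U) <= prod_(k <= i < n) i/(i+theta) and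
    E C_U <= sum_(k <= i < n) 1/i by induction on n-k.
    The second bound gives E ALG <= f_1 + 2 + l. The first one, with theta a large
    multiple of K = kappa b, b ~ 1 + l, beats the number of sets of size K:
    outside an event of probability n^-D every set of at most K facilities
    has connection cost at least (1-eps)l, while larger sets pay l for opening.
    Hence OPT >= f_1 + (1-eps)l there, and on the exceptional event the
    polynomial bound on f_n/f_1 makes the ratio negligible. *)

Set Implicit Arguments. Unset Strict Implicit. Unset Printing Implicit Defensive.

(** * Shortest paths and connection costs *)

(** Exploring the metric outwards from U suggests an exact law: once i vertices are reached, the
    next one appears after an Exp(i(n-i)) delay, which is charged to n-i vertices, so C_U behaves
    like a sum of independent Exp(i) variables, k <= i < n. The two bounds are the Laplace transform
    and the mean of that law. Only these inequalities are needed, so no exploration process or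
    conditional law is built: identities between integrals, tested on products of upper rays,
    replace conditioning, and the limit in h replaces stopping times. The factor b in K = kappa b is
    affordable because enlarging kappa to kappa b lowers the typical cost only by about ln b, which
    is negligible against l, while b - 1 >= l is what larger sets must pay. The cost f_1 need not be
    small; it occurs both in the bound on ALG and in the bound on OPT, and a comparison of fractions
    removes it. On the exceptional event only OPT >= f_1 is known, and 1/f_1 may be a power of n.
    That event involves all edges at once, so ALG is controlled there by second moments of the edge
    weights. *)

Section FiniteInf.
Context {R : realType}.

(** Every minimum of the model is a real infimum of a set. Over a finite nonempty index set it
    becomes an iterated minimum, from which attainment and measurability follow by induction. *)
Lemma inf_seq_bigmin (I : eqType) (F : I -> R) (i0 : I) (s : seq I) :
  inf [set F i | i in [set` i0 :: s]] = \big[Order.min/F i0]_(i <- s) F i.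
Proof.
set A := [set _ | _ in _]; set m := \big[_/_]_(_ <- _) _.
have lbm : lbound A m.
  move=> _ [i /= + <-]; rewrite inE => /orP[/eqP ->|si].
    exact: bigmin_le_id.
  exact: ge_bigmin_seq.
have Am : A m.
  rewrite /m; elim: s {m lbm} @A => [|j s IHs] A.
    by rewrite big_nil; exists i0; rewrite //= inE.
  rewrite big_cons minElt; case: ifP => _.
    by exists j; rewrite //= !inE eqxx orbT.
  have [i /= si <-] := IHs; exists i => //=.
  by move: si; rewrite !inE => /orP[->//|->]; rewrite !orbT.
apply/eqP; rewrite eq_le; apply/andP; split.
  by apply: ge_inf => //; exists m.
by apply: lb_le_inf => //; exists m.
Qed.

Lemma finite_set_cons (I : choiceType) (A : set I) :
  finite_set A -> A !=set0 -> exists i0 s, A = [set` i0 :: s].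
Proof.
by move=> /finite_seqP[[|i0 s] ->] [i]//; exists i0, s.
Qed.

Lemma inf_finite_ge (I : choiceType) (A : set I) (F : I -> R) (i : I) :
  finite_set A -> A i -> inf [set F i | i in A] <= F i.
Proof.
move=> fA Ai; have [||i0 [s As]] := finite_set_cons (A := A) => //.
  by exists i.
move: Ai; rewrite As inf_seq_bigmin /= inE => /orP[/eqP ->|si].
  exact: bigmin_le_id.
exact: ge_bigmin_seq.
Qed.

Lemma inf_finite_attained (I : choiceType) (A : set I) (F : I -> R) :
  finite_set A -> A !=set0 -> exists2 i, A i & inf [set F i | i in A] = F i.
Proof.
move=> fA /(finite_set_cons fA)[i0 [s ->]]; rewrite inf_seq_bigmin.
elim: s => [|j s [i si E]]; first by rewrite big_nil; exists i0; rewrite //= inE.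
rewrite big_cons minElt; case: ifP => _.
  by exists j; rewrite //= !inE eqxx orbT.
exists i => //=; move: si => /=.
by rewrite !inE => /orP[->//|->]; rewrite !orbT.
Qed.

Lemma measurable_inf_finite d (T : measurableType d) (I : choiceType)
    (A : set I) (F : I -> T -> R) :
  finite_set A -> A !=set0 -> (forall i, A i -> measurable_fun setT (F i)) ->
  measurable_fun setT (fun x => inf [set F i x | i in A]).
Proof.
move=> fA /(finite_set_cons fA)[i0 [s ->]] mF.
rewrite (_ : (fun x => _) = fun x => \big[Order.min/F i0 x]_(i <- s) F i x);
  last by apply/funext => x; rewrite inf_seq_bigmin.
elim: s mF => [|j s IHs] mF.
  rewrite (_ : (fun x => _) = F i0); last by apply/funext => x; rewrite big_nil.
  by apply: mF; rewrite /= inE.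
rewrite (_ : (fun x => _) = F j \min
    (fun x => \big[Order.min/F i0 x]_(i <- s) F i x)); last first.
  by apply/funext => x; rewrite big_cons.
apply: measurable_minr; first by apply: mF; rewrite /= !inE eqxx orbT.
apply: IHs => i /=; rewrite inE => /orP[/eqP ->|si]; apply: mF => /=.
  by rewrite !inE eqxx.
by rewrite !inE si !orbT.
Qed.

End FiniteInf.

Section Paths.
Context {R : realType} {n : nat}.
Implicit Types (w : 'I_n * 'I_n -> R) (u v : 'I_n) (p : seq 'I_n)
  (U : {set 'I_n}).

Definition conn w U v : R := inf [set dist w u v | u in [set u | u \in U]].

Definition conn_cost w U : R := \sum_v conn w U v.

Lemma flcostE f w U : flcost f w U = \sum_(i in U) f i + conn_cost w U.
Proof. by []. Qed.

Lemma path_weight_nil w u : path_weight w u [::] = 0.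
Proof. by rewrite /path_weight big_nil. Qed.

Lemma path_weight_cons w u v p :
  path_weight w u (v :: p) = wt w u v + path_weight w v p.
Proof. by rewrite /path_weight big_cons. Qed.

Lemma eq_path_weight w1 w2 u p :
  path (fun a b => wt w1 a b == wt w2 a b) u p ->
  path_weight w1 u p = path_weight w2 u p.
Proof.
elim: p u => [|v p IHp] u; first by rewrite !path_weight_nil.
by move=> /= /andP[/eqP e12 /IHp]; rewrite !path_weight_cons e12 => ->.
Qed.

Lemma path_weight_ge0 w u p : (forall e, 0 <= w e) -> 0 <= path_weight w u p.
Proof.
move=> w0; elim: p u => [|v p IHp] u; first by rewrite path_weight_nil.
by rewrite path_weight_cons addr_ge0// /wt; case: ifP.
Qed.

(** Vertices of a simple path are distinct, so its length is bounded and it embeds into a finite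
    type of bounded sequences. *)
Lemma finite_paths u v : finite_set [set p | is_path u v p].
Proof.
apply: (@sub_finite_set _ _ [set val (b : {bseq n of 'I_n}) | b in setT]).
  move=> p /andP[/= /andP[_ pu] _].
  have sp : (size p <= n)%N by rewrite -[n in leqRHS]card_ord -(card_uniqP pu) max_card.
  by exists (Bseq sp).
exact: finite_image.
Qed.

Lemma path_exists u v : exists p, is_path u v p.
Proof.
have [->|uv] := eqVneq u v; first by exists [::]; rewrite /is_path /= eqxx.
by exists [:: v]; rewrite /is_path /= inE uv eqxx.
Qed.

Lemma dist_le w u v p : is_path u v p -> dist w u v <= path_weight w u p.
Proof.
move=> puv; apply: (@inf_finite_ge _ _ [set p | is_path u v p]) => //.
exact: finite_paths.
Qed.

Lemma dist_attained w u v :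
  exists2 p, is_path u v p & dist w u v = path_weight w u p.
Proof. by apply: inf_finite_attained; [exact: finite_paths|exact: path_exists]. Qed.

(** A simple path never stays at a vertex, so [wt] reads only pairs satisfying [is_edge]. This
    allows the unspecified values of the weights off the edges to be replaced. *)
Lemma eq_dist w1 w2 u v :
  (forall e, is_edge e -> w1 e = w2 e) -> dist w1 u v = dist w2 u v.
Proof.
move=> w12; rewrite /dist; congr inf; apply: eq_imagel => p /andP[pu _].
apply: eq_path_weight; elim: p u pu => [//|x p IHp] u pu /=.
rewrite IHp ?andbT; last by case/andP: pu.
move: pu; rewrite /= inE negb_or -andbA => /and3P[ux _ _]; apply/eqP.
rewrite /wt; case: ltnP => [?|xu]; apply: w12 => //.
by rewrite /is_edge /= ltn_neqAle xu eq_sym ux.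
Qed.

Lemma eq_flcost f w1 w2 U :
  (forall e, is_edge e -> w1 e = w2 e) -> flcost f w1 U = flcost f w2 U.
Proof.
move=> w12; rewrite /flcost; congr (_ + _); apply: eq_bigr => v _.
by congr inf; apply: eq_imagel => u _; exact: eq_dist.
Qed.

Lemma conn_le w U u v p : u \in U -> is_path u v p ->
  conn w U v <= path_weight w u p.
Proof.
move=> uU /(dist_le w); apply: le_trans.
by apply: (@inf_finite_ge _ _ [set u | u \in U]).
Qed.

Lemma conn_attained_dist w U v : (0 < #|U|)%N ->
  exists2 u, u \in U & conn w U v = dist w u v.
Proof.
move=> /card_gt0P[u0 u0U].
by apply: (@inf_finite_attained _ _ [set u | u \in U]) => //; exists u0.
Qed.

(** The path is cut at its last visit to [U]; what is cut off has nonnegative weight. *)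
Lemma path_suffix_avoiding w U u v p : (forall e, 0 <= w e) ->
  is_path u v p -> has (mem U) (u :: p) ->
  exists u' p', [/\ u' \in U, is_path u' v p', all [predC U] p' &
    path_weight w u' p' <= path_weight w u p].
Proof.
move=> w0; elim: p u => [|x p IHp] u puv hU.
  by exists u, [::]; move: hU => /=; rewrite orbF.
have [hxp|] := boolP (has (mem U) (x :: p)).
  have xp : is_path x v p.
    by move: puv; rewrite /is_path /= => /andP[/andP[_ ->] ->].
  have [u' [p' [u'U u'p' ap' le]]] := IHp _ xp hxp.
  exists u', p'; split => //; apply: le_trans le _.
  by rewrite path_weight_cons lerDr /wt; case: ifP.
rewrite -all_predC => a; exists u, (x :: p); split => //.
move: hU => /= /orP[//|]; move: a => /= /andP[/negPf-> /=].
by rewrite all_predC => /negPf ->.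
Qed.

Lemma conn_attained w U v : (forall e, 0 <= w e) -> (0 < #|U|)%N ->
  exists u p, [/\ u \in U, is_path u v p, all [predC U] p &
    conn w U v = path_weight w u p].
Proof.
move=> w0 /(conn_attained_dist w v)[u uU cE].
have [p up dE] := dist_attained w u v.
have [|u' [p' [u'U u'p' ap' le]]] := path_suffix_avoiding w0 up (U := U).
  by rewrite /= uU.
exists u', p'; split => //; apply/eqP.
by rewrite eq_le conn_le// cE dE le.
Qed.

Lemma conn_ge0 w U v : (forall e, 0 <= w e) -> (0 < #|U|)%N -> 0 <= conn w U v.
Proof.
by move=> w0 /(conn_attained v w0)[u [p [_ _ _ ->]]]; exact: path_weight_ge0.
Qed.

Lemma conn_cost_ge0 w U :
  (forall e, 0 <= w e) -> (0 < #|U|)%N -> 0 <= conn_cost w U.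
Proof. by move=> w0 U0; apply: sumr_ge0 => v _; exact: conn_ge0. Qed.

Lemma conn_mem w U v : (forall e, 0 <= w e) -> v \in U -> conn w U v = 0.
Proof.
move=> w0 vU; apply/eqP; rewrite eq_le conn_ge0// ?andbT; last first.
  by apply/card_gt0P; exists v.
by rewrite -[leRHS](path_weight_nil w v) conn_le// /is_path /= eqxx.
Qed.

Lemma conn_cost_setT w : (forall e, 0 <= w e) -> conn_cost w [set: 'I_n]%SET = 0.
Proof. by move=> w0; apply: big1 => v _; rewrite conn_mem// inE. Qed.

Lemma conn_costS w U1 U2 : (forall e, 0 <= w e) -> (0 < #|U1|)%N ->
  U1 \subset U2 -> conn_cost w U2 <= conn_cost w U1.
Proof.
move=> w0 U10 /fintype.subsetP U12; apply: ler_sum => v _.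
have [u [p [uU up _ ->]]] := conn_attained v w0 U10.
by rewrite conn_le// U12.
Qed.

Lemma conn_cost_le_sum w U : (forall e, 0 <= w e) -> (0 < #|U|)%N ->
  conn_cost w U <= n%:R * \sum_e w e.
Proof.
move=> w0 /card_gt0P[u uU].
rewrite [leRHS](_ : _ = \sum_(v < n) \sum_e w e); last first.
  by rewrite sumr_const card_ord mulr_natl.
apply: ler_sum => v _.
have wle e : w e <= \sum_e w e.
  by rewrite (bigD1 e)//= lerDl sumr_ge0.
have [<-|uv] := eqVneq u v; first by rewrite conn_mem// sumr_ge0.
apply: (@le_trans _ _ (path_weight w u [:: v])).
  by rewrite conn_le// /is_path /= inE uv eqxx.
by rewrite path_weight_cons path_weight_nil addr0 /wt; case: ifP.
Qed.

(** An optimal path can be taken to avoid [U] after its start, so it uses no edge with both ends in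
    [U]. Applied to [v |: U], this makes the cost independent of the edge between [u] and [v]. *)
Lemma conn_eq_inside w1 w2 U v :
  (forall e, 0 <= w1 e) -> (forall e, 0 <= w2 e) -> (0 < #|U|)%N ->
  (forall e, ~~ ((e.1 \in U) && (e.2 \in U)) -> w1 e = w2 e) ->
  conn w1 U v = conn w2 U v.
Proof.
move=> w10 w20 U0 w12.
have pwE u p : all [predC U] p -> path_weight w1 u p = path_weight w2 u p.
  move=> ap; apply: eq_path_weight; elim: p u ap => //= x p IHp u /andP[xU ap].
  rewrite IHp// andbT /wt; case: ifP => _; apply/eqP; apply: w12 => /=.
    by rewrite (negPf xU) andbF.
  by rewrite (negPf xU).
apply/eqP; rewrite eq_le; apply/andP; split.
  have [u [p [uU up ap ->]]] := conn_attained v w20 U0.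
  by rewrite -pwE// conn_le.
have [u [p [uU up ap ->]]] := conn_attained v w10 U0.
by rewrite pwE// conn_le.
Qed.

Lemma conn_cost_eq_inside w1 w2 U :
  (forall e, 0 <= w1 e) -> (forall e, 0 <= w2 e) -> (0 < #|U|)%N ->
  (forall e, ~~ ((e.1 \in U) && (e.2 \in U)) -> w1 e = w2 e) ->
  conn_cost w1 U = conn_cost w2 U.
Proof. by move=> *; apply: eq_bigr => v _; exact: conn_eq_inside. Qed.

(** * Edges leaving a set of facilities *)

Definition cut_edges U : {set 'I_n * 'I_n} :=
  [set e | is_edge e && ((e.1 \in U) != (e.2 \in U))].

Lemma card_cut U : #|cut_edges U| = (#|U| * (n - #|U|))%N.
Proof.
pose ed (e : 'I_n * 'I_n) := if (e.1 < e.2)%N then e else (e.2, e.1).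
have -> : cut_edges U = ed @: finset.setX U (~: U).
  apply/setP => -[a b]; rewrite !inE /=; apply/idP/imsetP.
    rewrite /is_edge /= => /andP[ab].
    have [aU|aU] := boolP (a \in U).
      rewrite eq_sym eqb_id => bU; exists (a, b); first by rewrite !inE /= aU.
      by rewrite /ed /= ab.
    rewrite eq_sym eqbF_neg negbK => bU.
    exists (b, a); first by rewrite !inE /= bU.
    by rewrite /ed /= ltnNge ltnW.
  move=> [[c d]]; rewrite !inE /= => /andP[cU dU].
  rewrite /ed /is_edge /=; case: ltnP => [cd|dc] [-> ->] /=.
    by rewrite cd cU (negPf dU).
  rewrite cU (negPf dU) andbT ltn_neqAle dc andbT; apply: contra dU.
  by move=> /eqP/val_inj ->.
rewrite card_in_imset.
  by rewrite cardsX [#|~: _|]cardsCs finset.setCK card_ord.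
move=> [a b] [c d]; rewrite !inE /ed /= => /andP[aU bU] /andP[cU dU].
case: ltnP => _; case: ltnP => _ // [? ?]; subst => //.
- by rewrite aU in dU.
- by rewrite aU in dU.
Qed.

Definition shift_cut U (h : R) w : 'I_n * 'I_n -> R :=
  fun e => w e + (if e \in cut_edges U then h else 0).

Lemma wt_shift_cut U h w a b : a != b ->
  wt (shift_cut U h w) a b =
  wt w a b + (if (a \in U) != (b \in U) then h else 0).
Proof.
move=> ab; rewrite /wt /shift_cut; case: ltnP => [lt_ab|ba].
  by rewrite inE /is_edge /= lt_ab.
by rewrite inE /is_edge /= ltn_neqAle ba andbT eq_sym ab /= eq_sym.
Qed.

(** A path that avoids [U] after its start crosses the cut exactly once, at its first step. *)
Lemma path_weight_shift_cut U h w u v p : u \in U -> v \notin U ->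
  is_path u v p -> all [predC U] p ->
  path_weight (shift_cut U h w) u p = path_weight w u p + h.
Proof.
move=> uU vU /andP[pu /eqP lv].
case: p pu lv => [_ /= uv|x p /=]; first by rewrite -uv uU in vU.
rewrite inE negb_or -!andbA => /and4P[ux _ xp pu] _ /andP[xU ap].
rewrite !path_weight_cons wt_shift_cut// uU (negPf xU) /= [RHS]addrAC.
congr (_ + _); apply: eq_path_weight.
elim: p x xU xp pu ap {ux} => //= y p IHp x xU.
rewrite inE negb_or => /andP[xy _] /andP[yp pu] /andP[yU ap].
by rewrite IHp// andbT wt_shift_cut// (negPf xU) (negPf yU) eqxx addr0.
Qed.

Lemma shift_cut_ge0 U h w :
  0 <= h -> (forall e, 0 <= w e) -> forall e, 0 <= shift_cut U h w e.
Proof. by move=> h0 w0 e; rewrite /shift_cut addr_ge0//; case: ifP. Qed.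

(** All relevant paths gain the same [h], so a minimiser for either weight is a competitor for the
    other. *)
Lemma conn_shift_cut U h w v : 0 <= h -> (forall e, 0 <= w e) ->
  (0 < #|U|)%N -> v \notin U ->
  conn (shift_cut U h w) U v = conn w U v + h.
Proof.
move=> h0 w0 U0 vU; apply/eqP; rewrite eq_le; apply/andP; split.
  have [u [p [uU up ap ->]]] := conn_attained v w0 U0.
  by rewrite -(path_weight_shift_cut _ _ uU vU up ap) conn_le.
have [u [p [uU up ap ->]]] := conn_attained v (@shift_cut_ge0 U h w h0 w0) U0.
by rewrite (path_weight_shift_cut _ _ uU vU up ap) lerD2r conn_le.
Qed.

Lemma sum_notin_const U (h : R) :
  \sum_v (if v \in U then 0 else h) = (n - #|U|)%:R * h.
Proof.
rewrite (eq_bigr (fun v => if v \in ~: U then h else 0)); last first.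
  by move=> v _; rewrite inE; case: (v \in U).
have -> : (n - #|U|)%N = #|~: U| by rewrite [RHS]cardsCs finset.setCK card_ord.
by rewrite -big_mkcond sumr_const mulr_natl.
Qed.

Lemma conn_cost_shift_cut U h w : 0 <= h -> (forall e, 0 <= w e) ->
  (0 < #|U|)%N ->
  conn_cost (shift_cut U h w) U = conn_cost w U + (n - #|U|)%:R * h.
Proof.
move=> h0 w0 U0; rewrite -sum_notin_const -big_split /=.
apply: eq_bigr => v _; have [vU|vU] := boolP (v \in U); last exact: conn_shift_cut.
by rewrite !conn_mem ?addr0//; exact: shift_cut_ge0.
Qed.

(** A client served by [v] is rerouted through [u] for one extra edge. Clients in [U] pay nothing,
    which leaves [n - #|U|] surcharges. *)
Lemma conn_costU1 U w u v h : (forall e, 0 <= w e) ->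
  u \in U -> v \notin U -> wt w u v <= h ->
  conn_cost w U <= conn_cost w (v |: U) + (n - #|U|)%:R * h.
Proof.
move=> w0 uU vU uvh; rewrite -sum_notin_const -big_split /=.
have vU0 : (0 < #|v |: U|)%N by apply/card_gt0P; exists v; rewrite setU11.
have h0 : 0 <= h by apply: le_trans uvh; rewrite /wt; case: ifP.
apply: ler_sum => x _; have [xU|xU] := boolP (x \in U).
  by rewrite conn_mem// addr0 conn_ge0.
have [u' [p [u'U up ap ->]]] := conn_attained x w0 vU0.
move: u'U; rewrite !inE => /orP[/eqP u'v|u'U]; last first.
  by apply: le_trans (conn_le w u'U up) _; rewrite lerDl.
subst u'; have uvp : is_path u x (v :: p).
  move: up; rewrite /is_path /= => /andP[-> ->]; rewrite !andbT inE negb_or.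
  apply/andP; split; first by apply: contra vU => /eqP <-.
  by apply/negP => /(allP ap) /=; rewrite !inE uU orbT.
apply: le_trans (conn_le w uU uvp) _.
by rewrite path_weight_cons [leLHS]addrC lerD2l.
Qed.

End Paths.

Section PathsMeasurable.
Context {R : realType} {n : nat} d (T : measurableType d).
Variable Y : 'I_n * 'I_n -> T -> R.
Hypothesis mY : forall e, measurable_fun setT (Y e).

Lemma measurable_conn_cost (U : {set 'I_n}) : (0 < #|U|)%N ->
  measurable_fun setT (fun x => conn_cost (Y ^~ x) U).
Proof.
move=> U0; apply: measurable_sum => v.
apply: (@measurable_inf_finite _ _ _ _ [set u | u \in U]
  (fun u x => dist (Y ^~ x) u v)) => //.
  by move/card_gt0P : U0 => [u uU]; exists u.
move=> u _; apply: (@measurable_inf_finite _ _ _ _ [set p | is_path u v p]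
  (fun p x => path_weight (Y ^~ x) u p)).
- exact: finite_paths.
- exact: path_exists.
- move=> p _; elim: p u => [|a p IHp] u.
    rewrite (_ : (fun x => _) = cst 0)//.
    by apply/funext => x; rewrite path_weight_nil.
  rewrite (_ : (fun x => _) = (fun x => wt (Y ^~ x) u a) \+
      (fun x => path_weight (Y ^~ x) a p)); last first.
    by apply/funext => x; rewrite path_weight_cons.
  by apply: measurable_funD => //; rewrite /wt; case: (u < a)%N.
Qed.

Lemma measurable_flcost f (U : {set 'I_n}) : (0 < #|U|)%N ->
  measurable_fun setT (fun x => flcost f (Y ^~ x) U).
Proof.
by move=> U0; apply: measurable_funD => //; exact: measurable_conn_cost.
Qed.

Lemma measurable_OPT f : (0 < n)%N ->
  measurable_fun setT (fun x => OPT f (Y ^~ x)).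
Proof.
move=> n0; apply: (@measurable_inf_finite _ _ _ _
  [set U : {set 'I_n} | (0 < #|U|)%N] (fun U x => flcost f (Y ^~ x) U)).
- exact: finite_finset.
- by exists [set: 'I_n]%SET; rewrite /= cardsT card_ord.
- by move=> U U0; exact: measurable_flcost.
Qed.

End PathsMeasurable.

Section Optimum.
Context {R : realType} {n : nat}.

Lemma OPT_le (f : 'I_n -> R) w (U : {set 'I_n}) : (0 < #|U|)%N -> OPT f w <= flcost f w U.
Proof.
move=> U0; apply: (@inf_finite_ge _ _ [set U : {set 'I_n} | (0 < #|U|)%N]) => //.
exact: finite_finset.
Qed.

Lemma OPT_attained (f : 'I_n -> R) w : (0 < n)%N ->
  exists2 U : {set 'I_n}, (0 < #|U|)%N & OPT f w = flcost f w U.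
Proof.
move=> n0.
apply: (@inf_finite_attained _ _ [set U : {set 'I_n} | (0 < #|U|)%N]).
  exact: finite_finset.
by exists [set: 'I_n]%SET; rewrite /= cardsT card_ord.
Qed.

Lemma eq_OPT (f : 'I_n -> R) w1 w2 :
  (forall e, is_edge e -> w1 e = w2 e) -> OPT f w1 = OPT f w2.
Proof.
by move=> w12; congr inf; apply: eq_imagel => U _; exact: eq_flcost.
Qed.

End Optimum.

(** * Laws on families of real numbers *)

Lemma ge0_integral_mrestr d (T : measurableType d) (R : realType)
    (m : {measure set T -> \bar R}) (D : set T) (mD : measurable D)
    (f : T -> \bar R) : measurable_fun setT f -> (forall x, 0 <= f x)%E ->
  (\int[mrestr m mD]_x f x = \int[m]_(x in D) f x)%E.
Proof.
move=> mf f0; rewrite (ge0_negligible_integral (measurableC mD) measurableT)//.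
  rewrite setTD setCK; apply: eq_measure_integral => A mA AD.
  by rewrite /= /mrestr setIidl.
by rewrite /= /mrestr setICl measure0.
Qed.

Section RayBoxes.
Context {R : realType} {E : finType}.

(** A separate name for the function type, on which the structures needed by [g_sigma_algebraType]
    are declared. *)
Definition family : Type := E -> R.

HB.instance Definition _ := gen_eqMixin family.
HB.instance Definition _ := gen_choiceMixin family.
HB.instance Definition _ := isPointed.Build family (fun=> 0).

(** Upper orthants are stable under intersection, by taking maxima, and for independent weights
    their probability is a product of survival functions, the form in which memorylessness is a
    factorisation. *)
Definition ray_box (a : family) : set family := [set w | forall e, a e < w e].

Definition ray_boxes : set (set family) := range ray_box.

Local Notation weights := (g_sigma_algebraType ray_boxes).

Lemma setI_closed_ray_boxes : setI_closed ray_boxes.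
Proof.
move=> _ _ [a _ <-] [b _ <-]; exists (fun e => Order.max (a e) (b e)) => //.
apply/seteqP; split => w /=.
  by move=> abw; split=> e; have := abw e; rewrite gt_max => /andP[].
by move=> [aw bw] e; rewrite gt_max aw bw.
Qed.

Lemma measurable_ray_box a : measurable (ray_box a : set weights).
Proof. by apply: sub_sigma_algebra; exists a. Qed.

Lemma bigcup_ray_box : \bigcup_k ray_box (fun=> - k%:R) = setT.
Proof.
rewrite -subTset => w _; pose m := \sum_e `|w e|.
exists (Num.truncn m).+1 => // e /=.
rewrite ltrNl; apply: le_lt_trans (truncnS_gt m).
apply: le_trans (_ : `|w e| <= _); first by rewrite -normrN ler_norm.
by rewrite /m (bigD1 e)//= lerDl sumr_ge0.
Qed.

Lemma measurable_coord e : measurable_fun setT (fun w : weights => w e).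
Proof.
apply: (measurability _ (RGenOInfty.measurableE R)) => //.
move=> _ [_ [a ->] <-]; rewrite setTI.
(* A box constrains all coordinates strictly, so a condition on coordinate [e] alone is a union over
   [k] of boxes with bound [-k] elsewhere. *)
rewrite (_ : _ @^-1` _ = \bigcup_k
    ray_box (fun e' => if e' == e then a else - k%:R)); last first.
  apply/seteqP; split => w /=.
    rewrite in_itv/= andbT => aw.
    have : (\bigcup_k ray_box (fun=> - k%:R)) w by rewrite bigcup_ray_box.
    move=> [k _ kw]; exists k => // e' /=; case: eqP => [->//|_]; exact: kw.
  by move=> [k _ /(_ e)]; rewrite eqxx in_itv/= andbT.
by apply: bigcupT_measurable => k; exact: measurable_ray_box.
Qed.

Context d (T : measurableType d).

Definition ray (Z : E -> T -> R) (a : E -> R) : set T :=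
  [set x | forall e, a e < Z e x].

Lemma measurable_ray (Z : E -> T -> R) (a : E -> R) :
  (forall e, measurable_fun setT (Z e)) ->
  measurable (ray Z a).
Proof.
move=> mZ; rewrite (_ : ray Z a = \bigcap_(e in setT) (Z e @^-1` `]a e, +oo[)).
  apply: fin_bigcap_measurable => // e _; rewrite -[X in measurable X]setTI.
  exact: mZ.
by apply/seteqP; split => x /= H e; [move=> _|have := H e I]; rewrite /= in_itv/= ?andbT.
Qed.

Lemma measurable_family (Z : E -> T -> R) :
  (forall e, measurable_fun setT (Z e)) ->
  measurable_fun setT (fun x => Z ^~ x : weights).
Proof.
move=> mZ; apply: (@measurability _ _ _ weights setT _ ray_boxes) => //.
by move=> _ [_ [a _ <-] <-]; rewrite setTI; exact: measurable_ray.
Qed.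

Variable P : probability T R.

(* A law on the product space is determined by the ray boxes, a pi-system. *)
Lemma integral_ray_transfer (D : set T) (c : R) (Z Z' : E -> T -> R) :
  measurable D -> 0 <= c ->
  (forall e, measurable_fun setT (Z e)) ->
  (forall e, measurable_fun setT (Z' e)) ->
  (forall a, P (ray Z a `&` D) = (c%:E * P (ray Z' a))%E) ->
  forall g : weights -> \bar R, measurable_fun setT g ->
    (forall w, 0 <= g w)%E ->
  (\int[P]_(x in D) g (Z ^~ x) = c%:E * \int[P]_x g (Z' ^~ x))%E.
Proof.
move=> mD c0 mZ mZ' ZZ' g mg g0.
have mfZ := measurable_family mZ; have mfZ' := measurable_family mZ'.
pose fZ x : weights := Z ^~ x; pose fZ' x : weights := Z' ^~ x.
(* [m1] is the unnormalised law of [Z] on the event [D]; comparing it with [c] times the law of [Z']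
   does the work of a conditional law. *)
pose M1 : {measure set weights -> \bar R} := pushforward (mrestr P mD) fZ.
pose M2 : {measure set weights -> \bar R} := pushforward P fZ'.
pose m1 := M1 mfZ.
pose m2 : {measure set weights -> \bar R} := mscale (NngNum c0) (M2 mfZ').
have m12 (A : set weights) : measurable A -> m1 A = m2 A.
  move=> mA; apply: (@measure_unique _ _ weights ray_boxes
    (fun k => ray_box (fun=> - k%:R)) erefl _ _ _ m1 m2) => //.
  - exact: setI_closed_ray_boxes.
  - by move=> i; exists (fun=> - i%:R).
  - exact: bigcup_ray_box.
  - move=> _ [a _ <-].
    by rewrite /m1 /m2 /= /mscale /= /pushforward /mrestr /= ZZ'.
  - move=> k; rewrite /m1 /= /pushforward /mrestr.
    apply: le_lt_trans (_ : (P setT < +oo)%E); last by rewrite probability_setT ltry.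
    apply: le_measure => //; rewrite inE; last exact: measurableT.
    by apply: measurableI => //; exact: measurable_ray.
transitivity (\int[m1]_w g w)%E.
  rewrite ge0_integral_pushforward//= preimage_setT.
  by rewrite ge0_integral_mrestr//; exact: measurableT_comp.
rewrite (eq_measure_integral m2); last by move=> A mA _; exact: m12.
rewrite ge0_integral_mscale//=; congr (_ * _)%E.
by rewrite ge0_integral_pushforward//= preimage_setT.
Qed.

End RayBoxes.

(** * Exponential edge weights *)

(** To first order in [h] the hypothesis says [p <= p - c p h + (alpha + beta) h]; the terms with
    [gamma] are of second order. Dividing by [h] and letting it tend to 0 gives the claim. *)
Lemma ler_limit_step (R : realType) (p c alpha beta gamma : R) :
  0 <= p -> 0 < c -> 0 <= alpha -> 0 <= beta -> 0 <= gamma ->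
  (forall h, 0 < h ->
     p <= expR (- (c * h)) * (p + alpha * h) + h * (beta + gamma * h)) ->
  c * p <= alpha + beta.
Proof.
move=> p0 c0 a0 b0 g0 H; apply/ler_addgt0Pr => e e0.
(* [K h] dominates the excess of [(1 + c h)(alpha + beta + gamma h)] over [alpha + beta] when
   [h <= 1]; the final 1 keeps [K] positive. *)
pose K := c * (alpha + beta) + gamma + c * gamma + 1.
have K0 : 0 < K by rewrite /K; nra.
pose h := Order.min 1 (e / K).
have h0 : 0 < h by rewrite /h lt_min ltr01 divr_gt0.
have h1 : h <= 1 by rewrite /h ge_min lexx.
have hK : K * h <= e.
  have : h <= e / K by rewrite /h ge_min lexx orbT.
  by rewrite ler_pdivlMr// mulrC.
have ch0 : 0 < 1 + c * h by nra.
have e1 : expR (- (c * h)) <= 1 by rewrite -expR0 ler_expR oppr_le0 mulr_ge0 // ltW.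
have e2 : expR (- (c * h)) * (1 + c * h) <= 1.
  rewrite expRN mulrC ler_pdivrMr ?expR_gt0// mul1r; exact: expR_ge1Dx.
have {H} := H h h0; have q0 : 0 <= expR (- (c * h)) by exact: expR_ge0.
move: q0 e1 e2; set q := expR _ => q0 q1 qch H.
have s1 : p * (1 + c * h) <= p + (1 + c * h) * h * (alpha + beta + gamma * h).
  have H1 : p * (1 + c * h) <=
      (q * (p + alpha * h) + h * (beta + gamma * h)) * (1 + c * h).
    by rewrite ler_pM2r.
  have H2 : q * (1 + c * h) * p <= p by rewrite -[leRHS]mul1r ler_wpM2r.
  have H3 : (1 + c * h) * h * (q * alpha) <= (1 + c * h) * h * alpha.
    apply: ler_wpM2l; first by rewrite mulr_ge0 ?ltW.
    by rewrite -[leRHS]mul1r ler_wpM2r.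
  lra.
have s2 : c * p <= (1 + c * h) * (alpha + beta + gamma * h).
  rewrite -(ler_pM2l h0); nra.
apply: le_trans s2 _; apply: le_trans (_ : alpha + beta + K * h <= _); last first.
  by rewrite lerD2l.
rewrite /K.
have : 0 <= c * gamma * h * (1 - h) by rewrite !mulr_ge0 ?subr_ge0// ltW.
nra.
Qed.

Section ExpWeights.
Context {R : realType} {n : nat} d (T : measurableType d).
Variables (P : probability T R) (Y : 'I_n * 'I_n -> T -> R).

(** The probability of exceeding [a]: exponential on an edge, and for other pairs that of the
    constant weight 0. With it, [Y_ray] states the marginals and the independence in one formula. *)
Definition survival (e : 'I_n * 'I_n) (a : R) : R :=
  if is_edge e then expR (- Order.max 0 a) else (a < 0)%R%:R.

Hypothesis mY : forall e, measurable_fun setT (Y e).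
Hypothesis Y_ge0 : forall e x, 0 <= Y e x.
Hypothesis Y_nonedge : forall e x, ~~ is_edge e -> Y e x = 0.
Hypothesis Y_ray : forall a, P (ray Y a) = (\prod_e survival e (a e))%:E.

Local Notation weights := (g_sigma_algebraType (@ray_boxes R ('I_n * 'I_n)%type)).

(** Memorylessness: exceeding both [a] and [h] means exceeding their maximum. *)
Lemma survival_max e h a : is_edge e -> 0 <= h ->
  survival e (Order.max a h) = expR (- h) * survival e (a - h).
Proof.
move=> ee h0; rewrite /survival ee -expRD; congr expR.
rewrite -opprD; congr (- _); rewrite maxA.
have [a0|a0] := lerP 0 a; have [ah|ah] := lerP 0 (a - h); rewrite ?addr0.
- by rewrite addrC subrK; apply/max_idPl; rewrite -subr_ge0.
- by apply/max_idPr; rewrite -subr_le0 ltW.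
- by exfalso; lra.
- by apply/max_idPr.
Qed.

Definition beyond_cut (U : {set 'I_n}) (h : R) : set T :=
  [set x | forall e, e \in cut_edges U -> h < Y e x].

(** Weights are nonnegative, so the bound -1 imposes no condition on a coordinate; the same device
    recurs below. *)
Lemma beyond_cutE U h :
  beyond_cut U h = ray Y (fun e => if e \in cut_edges U then h else -1).
Proof.
apply/seteqP; split => x /= H e.
  by case: ifPn => [/H//|_]; apply: lt_le_trans (Y_ge0 e x); rewrite ltrN10.
by move=> eU; have := H e; rewrite eU.
Qed.

Lemma measurable_beyond_cut U h : measurable (beyond_cut U h).
Proof. by rewrite beyond_cutE; exact: measurable_ray. Qed.

(** Memorylessness of the whole cut at once: on this event the family is distributed as the shifted
    family, up to the probability of the event. *)
Lemma integral_beyond_cut U h (g : weights -> \bar R) : 0 <= h ->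
  measurable_fun setT g -> (forall w, 0 <= g w)%E ->
  (\int[P]_(x in beyond_cut U h) g (Y ^~ x) =
   (expR (- (#|cut_edges U|%:R * h)))%:E *
     \int[P]_x g (shift_cut U h (Y ^~ x)))%E.
Proof.
move=> h0; apply: (integral_ray_transfer (Z' := fun e x => shift_cut U h (Y ^~ x) e)) => //.
- exact: measurable_beyond_cut.
- by move=> e; apply: measurable_funD => //; case: (e \in cut_edges U).
move=> a.
have -> : ray Y a `&` beyond_cut U h =
    ray Y (fun e => if e \in cut_edges U then Order.max (a e) h else a e).
  apply/seteqP; split => x /=.
    move=> [aY hY] e; case: ifPn => [eU|_]; last exact: aY.
    by rewrite gt_max aY hY.
  move=> H; split => e; have := H e.
    by case: ifPn => // _; rewrite gt_max => /andP[].
  by move=> + eU; rewrite eU gt_max => /andP[].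
have -> : ray (fun e x => shift_cut U h (Y^~ x) e) a =
    ray Y (fun e => a e - if e \in cut_edges U then h else 0).
  by apply/seteqP; split => x /= H e; have := H e; rewrite /shift_cut ltrBlDr.
rewrite !Y_ray -EFinM; congr EFin.
rewrite -mulrN expRM_natl -prodr_const.
rewrite [X in _ = X * _]big_mkcond -big_split /=; apply: eq_bigr => e _.
case: ifPn => [|_]; last by rewrite mul1r subr0.
by rewrite inE => /andP[ee _]; exact: survival_max.
Qed.

(** Setting the weight to 0 instead of dropping it keeps the index type, so the same cost functions
    and the same transfer lemma apply. *)
Definition erase (j e : 'I_n * 'I_n) (x : T) : R := if e == j then 0 else Y e x.

Lemma measurable_erase j e : measurable_fun setT (erase j e).
Proof. by rewrite /erase; case: eqP => _. Qed.

Lemma erase_ge0 j e x : 0 <= erase j e x.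
Proof. by rewrite /erase; case: ifP. Qed.

Lemma measurable_le_edge j h : measurable [set x | Y j x <= h].
Proof.
rewrite (_ : [set x | _] = Y j @^-1` `]-oo, h]); last first.
  by apply/seteqP; split => x /=; rewrite in_itv.
by rewrite -[X in measurable X]setTI; exact: mY.
Qed.

(** Independence of edge [j] from all the others, checked on ray boxes. *)
Lemma integral_le_edge j h (g : weights -> \bar R) : is_edge j -> 0 <= h ->
  measurable_fun setT g -> (forall w, 0 <= g w)%E ->
  (\int[P]_(x in [set x | (Y j x <= h)%R]) g (erase j ^~ x) =
   (1 - expR (- h))%:E * \int[P]_x g (erase j ^~ x))%E.
Proof.
move=> jj h0; apply: integral_ray_transfer.
- exact: measurable_le_edge.
- by rewrite subr_ge0 -expR0 ler_expR oppr_le0.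
- exact: measurable_erase.
- exact: measurable_erase.
move=> a; have [aj0|aj0] := ltP (a j) 0; last first.
  have -> : ray (erase j) a = set0.
    rewrite -subset0 => x /(_ j); rewrite /erase eqxx => aj.
    by have := lt_le_trans aj aj0; rewrite ltxx.
  by rewrite set0I measure0 mule0.
pose b z e := if e == j then z else a e.
have b0 : ray (erase j) a = ray Y (b (-1)).
  apply/seteqP; split => x /= H e; have := H e; rewrite /erase /b.
    by case: eqP => // _ _; apply: lt_le_trans (Y_ge0 e x); rewrite ltrN10.
  by case: eqP => // ->.
(* An upper bound on one coordinate is not a ray, but it is a difference of two nested ray boxes. *)
have b1 : ray (erase j) a `&` [set x | Y j x <= h] =
    ray Y (b (-1)) `\` ray Y (b h).
  rewrite b0; apply/seteqP; split => x /= [Hx Hj]; split => //.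
    by move=> /(_ j); rewrite /b eqxx; apply/negP; rewrite -leNgt.
  rewrite leNgt; apply/negP => hj; apply: Hj => e; have := Hx e.
  by rewrite /b; case: eqP => // ->.
rewrite b1 measureD; [|exact: measurable_ray|exact: measurable_ray|]; last first.
  by rewrite (le_lt_trans (probability_le1 _ _)) ?ltry//; exact: measurable_ray.
have -> : ray Y (b (-1)) `&` ray Y (b h) = ray Y (b h).
  apply/seteqP; split => x /=; first by case.
  move=> H; split => // e; have := H e; rewrite /b; case: eqP => // -> _.
  by apply: lt_le_trans (Y_ge0 j x); rewrite ltrN10.
rewrite b0; transitivity ((\prod_e survival e (b (-1) e))%:E -
    (\prod_e survival e (b h e))%:E)%E; first by rewrite -!Y_ray.
rewrite Y_ray -EFinB -EFinM; congr EFin.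
have bE z : \prod_e survival e (b z e) =
    survival j z * \prod_(e | e != j) survival e (a e).
  rewrite (bigD1 j)//= /b eqxx; congr (_ * _).
  by apply: eq_bigr => e /negPf ->.
rewrite !bE /survival jj (max_r h0) (@max_l _ _ 0 (-1)) ?lerN10// oppr0 expR0; ring.
Qed.

(** Off [beyond_cut] some cut edge is at most [h], and the union bound counts each such edge. For
    independent exponential weights, two short edges occur together with probability of order [h^2],
    so the overcount disappears in the limit. *)
Lemma integral_cut_split U h (F : T -> \bar R) :
  measurable_fun setT F -> (forall x, 0 <= F x)%E ->
  (\int[P]_x F x <= \int[P]_(x in beyond_cut U h) F x +
    \sum_(j in cut_edges U) \int[P]_(x in [set x | (Y j x <= h)%R]) F x)%E.
Proof.
move=> mF F0; have mB := measurable_beyond_cut U h.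
rewrite -[X in (\int[P]_(x in X) _ <= _)%E](setUv (beyond_cut U h)).
rewrite ge0_integral_setU//; last 3 first.
- exact: measurableC.
- exact: measurable_funTS.
- exact/disj_setPCl.
apply: leeD2l; rewrite integral_mkcond.
under eq_bigr do rewrite integral_mkcond.
rewrite -big_enum /= -ge0_integral_sum//; last 2 first.
- move=> j; apply/(measurable_restrictT _ _).1; first exact: measurable_le_edge.
  exact: measurable_funTS.
- by move=> j x _; exact: erestrict_ge0.
apply: ge0_le_integral => //.
- by move=> x _; exact: erestrict_ge0.
- apply/(measurable_restrictT _ _).1; first exact: measurableC.
  exact: measurable_funTS.
- apply: emeasurable_sum => j.
  apply/(measurable_restrictT _ _).1; first exact: measurable_le_edge.
  exact: measurable_funTS.
move=> x _; rewrite big_enum /= patchE; case: ifPn => [|_]; last first.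
  by apply: sume_ge0 => j _; exact: erestrict_ge0.
rewrite inE => /existsNP[j /not_implyP[jU /negP]]; rewrite -leNgt => jh.
rewrite (bigD1 j)//= [X in (_ <= X + _)%E]patchE ifT ?inE// leeDl//.
by apply: sume_ge0 => i _; exact: erestrict_ge0.
Qed.

Lemma cut_edgesP U j : j \in cut_edges U -> exists u v,
  [/\ u \in U, v \notin U, is_edge j, (j.1 \in v |: U) && (j.2 \in v |: U) &
   forall w : 'I_n * 'I_n -> R, wt w u v = w j].
Proof.
case: j => a b; rewrite !inE /is_edge /= => /andP[ab].
have [aU|aU] := boolP (a \in U).
  rewrite eq_sym eqb_id => bU; exists a, b; split => //.
    by rewrite !inE /= aU eqxx orbT.
  by move=> w; rewrite /wt ab.
rewrite eq_sym eqbF_neg negbK => bU; exists b, a; split => //.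
  by rewrite !inE /= eqxx bU orbT.
by move=> w; rewrite /wt ltnNge ltnW.
Qed.

Lemma measurable_weights_cost (U : {set 'I_n}) : (0 < #|U|)%N ->
  measurable_fun setT (fun w : weights => conn_cost w U).
Proof.
exact: (@measurable_conn_cost _ _ _ weights (fun e w => w e) (@measurable_coord _ _)).
Qed.

(** One step shared by the Laplace transform and the mean. [G'] absorbs the rerouting surcharge and
    is evaluated at the cost of [v |: U]; the factor [h] multiplying [B] bounds [1 - exp(-h)]. *)
Lemma integral_cost_step (U : {set 'I_n}) h B (G G' : R -> R) : (0 < #|U|)%N -> 0 <= h ->
  measurable_fun setT G -> measurable_fun setT G' ->
  (forall c, 0 <= G c) -> (forall c, 0 <= G' c) ->
  (forall c c', 0 <= c' -> c' <= c <= c' + (n - #|U|)%:R * h -> G c <= G' c') ->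
  0 <= B ->
  (forall v, v \notin U ->
    (\int[P]_x (G' (conn_cost (Y ^~ x) (v |: U)))%:E <= B%:E)%E) ->
  (\int[P]_x (G (conn_cost (Y ^~ x) U))%:E <=
   (expR (- (#|cut_edges U|%:R * h)))%:E *
     \int[P]_x (G (conn_cost (Y ^~ x) U + (n - #|U|)%:R * h))%:E +
   (#|cut_edges U|%:R * h * B)%:E)%E.
Proof.
move=> U0 h0 mG mG' G0 G'0 GG' B0 HB.
have mC (U' : {set 'I_n}) : (0 < #|U'|)%N ->
    measurable_fun setT (fun x => conn_cost (Y ^~ x) U').
  exact: measurable_conn_cost.
apply: le_trans (integral_cut_split U h _ _) _.
- by apply/measurable_EFinP; apply: measurableT_comp => //; exact: mC.
- by move=> x; rewrite lee_fin.
apply: leeD.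
  rewrite (integral_beyond_cut U (g := fun w => (G (conn_cost w U))%:E))//; last 2 first.
  - apply/measurable_EFinP; apply: measurableT_comp => //.
    exact: measurable_weights_cost.
  - by move=> w; rewrite lee_fin.
  under eq_integral do rewrite conn_cost_shift_cut//.
  exact: lexx.
apply: (@le_trans _ _ (\sum_(j in cut_edges U) (h * B)%:E)%E); last first.
  by rewrite sumEFin lee_fin sumr_const -mulrA mulr_natl.
apply: lee_sum => j jU; have [u [v [uU vU jj jin wtj]]] := cut_edgesP jU.
have vU0 : (0 < #|v |: U|)%N by apply/card_gt0P; exists v; rewrite setU11.
(* Both ends of [j] lie in [v |: U], so this cost does not see [j] and may be integrated
   independently of the event that [j] is short. *)
have eraseE x : conn_cost (erase j ^~ x) (v |: U) = conn_cost (Y ^~ x) (v |: U).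
  apply: conn_cost_eq_inside => //; first by move=> e; exact: erase_ge0.
  by move=> e; rewrite /erase; case: eqP => // ->; rewrite jin.
apply: (@le_trans _ _ (\int[P]_(x in [set x | (Y j x <= h)%R])
    (G' (conn_cost (erase j ^~ x) (v |: U)))%:E)%E).
  apply: ge0_le_integral => //.
  - exact: measurable_le_edge.
  - by move=> x _; rewrite lee_fin.
  - apply: measurable_funTS; apply/measurable_EFinP.
    by apply: measurableT_comp => //; exact: mC.
  - apply: measurable_funTS; apply/measurable_EFinP.
    apply: measurableT_comp => //; under [X in measurable_fun _ X]eq_fun do rewrite eraseE.
    exact: mC.
  - move=> x /= jh; rewrite lee_fin eraseE; apply: GG'.
      exact: conn_cost_ge0.
    rewrite conn_costS//= ?finset.subsetUr//.
    by apply: (@conn_costU1 _ _ _ _ u) => //; rewrite wtj.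
rewrite (integral_le_edge (g := fun w => (G' (conn_cost w (v |: U)))%:E))//; last 2 first.
- apply/measurable_EFinP; apply: measurableT_comp => //.
  exact: measurable_weights_cost.
- by move=> w; rewrite lee_fin.
under eq_integral do rewrite eraseE.
rewrite EFinM; apply: lee_pmul.
- by rewrite lee_fin subr_ge0 -expR0 ler_expR oppr_le0.
- by apply: integral_ge0 => x _; rewrite lee_fin.
- by rewrite lee_fin; have := expR_ge1Dx (- h); lra.
- exact: HB.
Qed.

Lemma card_setU1_notin (U : {set 'I_n}) v : v \notin U -> #|v |: U| = #|U|.+1.
Proof. by move=> vU; rewrite cardsU1 vU. Qed.

Lemma integral_cst_prob (r : \bar R) : (\int[P]_x r = r)%E.
Proof.
rewrite [LHS](integral_cst P measurableT r) [X in (_ * X)%E](_ : _ = 1%E).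
  by rewrite mule1.
exact: probability_setT.
Qed.

Lemma ge0_integralDcst (F : T -> R) c : measurable_fun setT F ->
  (forall x, 0 <= F x) -> 0 <= c ->
  (\int[P]_x (F x + c)%:E = \int[P]_x (F x)%:E + c%:E)%E.
Proof.
move=> mF F0 c0; under eq_integral do rewrite EFinD.
rewrite ge0_integralD//=.
- by rewrite integral_cst_prob.
- by move=> x _; rewrite lee_fin.
- exact/measurable_EFinP.
Qed.

Lemma laplace_conn_cost theta (U : {set 'I_n}) : 0 <= theta -> (0 < #|U|)%N ->
  (\int[P]_x (expR (- (theta * conn_cost (Y ^~ x) U)))%:E <=
   (\prod_(#|U| <= i < n) (i%:R / (i%:R + theta)))%:E)%E.
Proof.
move=> th0; have [k] := ubnP (n - #|U|); elim: k U => // k IHk U.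
rewrite ltnS => Uk U0.
have mG : measurable_fun setT (fun c : R => expR (- (theta * c))).
  apply: (measurableT_comp (f := expR)) => //.
  rewrite (_ : (fun x => _) = *%R (- theta)); first exact: mulrl_measurable.
  by apply/funext => c; rewrite mulNr.
have mC := measurable_conn_cost mY U0.
have mGC : measurable_fun setT
    (fun x => (expR (- (theta * conn_cost (Y ^~ x) U)))%:E).
  by apply/measurable_EFinP; apply: (measurableT_comp mG).
have int1 : (\int[P]_x (expR (- (theta * conn_cost (Y ^~ x) U)))%:E <= 1)%E.
  apply: (@le_trans _ _ (\int[P]_x (cst 1%E) x)%E).
    apply: ge0_le_integral => //.
    move=> x _; rewrite lee_fin -expR0 ler_expR oppr_le0 mulr_ge0//.
      exact: conn_cost_ge0.
  by rewrite integral_cst_prob.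
have [nU|Un] := leqP n #|U|; first by rewrite big_geq.
have int0 : (0 <= \int[P]_x (expR (- (theta * conn_cost (Y ^~ x) U)))%:E)%E.
  by apply: integral_ge0 => x _; rewrite lee_fin expR_ge0.
have intE : (\int[P]_x (expR (- (theta * conn_cost (Y ^~ x) U)))%:E)%E =
    (fine (\int[P]_x (expR (- (theta * conn_cost (Y ^~ x) U)))%:E))%:E.
  by rewrite fineK// ge0_fin_numE// (le_lt_trans int1)// ltry.
have p0 := fine_ge0 int0.
rewrite big_ltn//; set B := \prod_(_ <= _ < _) _.
have B0 : 0 <= B.
  by apply: prodr_ge0 => i _; rewrite divr_ge0 ?addr_ge0.
rewrite intE lee_fin; move: p0 intE; set p := fine _ => p0 intE.
have nU0 : 0 < (n - #|U|)%:R :> R by rewrite ltr0n subn_gt0.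
have U0R : 0 < #|U|%:R :> R by rewrite ltr0n.
pose m : R := #|cut_edges U|%:R.
have mE : m = #|U|%:R * (n - #|U|)%:R by rewrite /m card_cut natrM.
(* In the limit, [(m + theta N) p <= m B] with [N = n - #|U|] and [m = #|U| N]; dividing by [N]
   yields the factor [#|U| / (#|U| + theta)]. *)
have /ler_limit_step : forall h, 0 < h ->
    p <= expR (- ((m + theta * (n - #|U|)%:R) * h)) * (p + 0 * h) +
      h * (m * B + 0 * h).
  move=> h h0; rewrite -lee_fin -intE.
  apply: le_trans (integral_cost_step (h := h) (B := B)
    (G := fun c => expR (- (theta * c))) (G' := fun c => expR (- (theta * c)))
    _ _ _ _ _ _ _ _ _) _ => //.
  - exact: ltW.
  - by move=> c c' c'0 /andP[c'c _]; rewrite ler_expR lerN2 ler_wpM2l.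
  - move=> v vU; rewrite /B -(card_setU1_notin vU); apply: IHk.
      by rewrite card_setU1_notin// subnS -ltnS prednK ?subn_gt0.
    by rewrite card_setU1_notin.
  rewrite !mul0r !addr0 EFinD; apply: leeD; last first.
    by rewrite lee_fin /m mulrAC [leLHS]mulrC mulrA.
  under eq_integral do rewrite mulrDr opprD expRD mulrC EFinM.
  rewrite ge0_integralZl_EFin//.
  rewrite intE -!EFinM lee_fin mulrA -expRD; apply: ler_wpM2r => //.
  by rewrite ler_expR /m; nra.
have c0 : 0 < m + theta * (n - #|U|)%:R by rewrite mE; nra.
move=> /(_ p0 c0 (lexx _) (mulr_ge0 (ler0n _ _) B0) (lexx _)); rewrite add0r.
move=> H; rewrite mulrAC ler_pdivlMr; last by rewrite ltr_wpDr.
by rewrite -(ler_pM2r nU0); move: H; rewrite mE; lra.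
Qed.

(** * Moments of single edges and costs on small events *)

Lemma survival_edge e a : P [set x | a < Y e x] = (survival e a)%:E.
Proof.
pose b e' := if e' == e then a else -1.
have -> : [set x | a < Y e x] = ray Y b.
  apply/seteqP; split => x /=; last by move=> /(_ e); rewrite /b eqxx.
  move=> aY e'; rewrite /b; case: eqP => [->//|_].
  by apply: lt_le_trans (Y_ge0 e' x); rewrite ltrN10.
rewrite Y_ray (bigD1 e)//= /b eqxx big1 ?mulr1// => e' /negPf ->.
rewrite /survival; case: ifP => _; last by rewrite ltrN10.
by rewrite max_l ?lerN10// oppr0 expR0.
Qed.

Lemma integral_edge_memoryless e (h : R) (g : R -> R) : is_edge e -> 0 <= h ->
  measurable_fun setT g -> (forall y, 0 <= g y) ->
  (\int[P]_(x in [set x | (h < Y e x)%R]) (g (Y e x))%:E =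
   (expR (- h))%:E * \int[P]_x (g (Y e x + h))%:E)%E.
Proof.
move=> ee h0 mg g0.
have mD : measurable [set x | h < Y e x].
  rewrite (_ : [set x | _] = ~` [set x | Y e x <= h]).
    by apply: measurableC; exact: measurable_le_edge.
  by apply/seteqP; split => x /=; rewrite ltNge => /negP.
(* A family indexed by [unit] turns the transfer lemma into a statement about one variable. *)
pose Z' (_ : unit) x := Y e x + h.
have tr a : P (ray (fun _ : unit => Y e) a `&` [set x | h < Y e x]) =
    ((expR (- h))%:E * P (ray Z' a))%E.
  have -> : ray (fun _ : unit => Y e) a `&` [set x | h < Y e x] =
      [set x | Order.max (a tt) h < Y e x].
    apply/seteqP; split => x /=.
      by move=> [/(_ tt) aY hY]; rewrite gt_max aY.
    by rewrite gt_max => /andP[aY hY]; split => // -[].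
  have -> : ray Z' a = [set x | a tt - h < Y e x].
    rewrite /Z'; apply/seteqP; split => x /=; first by move=> /(_ tt); rewrite ltrBlDr.
    by rewrite ltrBlDr => H -[].
  by rewrite !survival_edge survival_max// EFinM.
have mZ (_ : unit) : measurable_fun setT (Y e) by [].
have mZ' u : measurable_fun setT (Z' u) by exact: measurable_funD.
apply: (@integral_ray_transfer _ _ _ _ _ _ _ _ _ mD (expR_ge0 _) mZ mZ' tr
  (fun w => (g (w tt))%:E)) => //.
  by apply/measurable_EFinP; apply: measurableT_comp => //; exact: measurable_coord.
by move=> w; rewrite lee_fin.
Qed.

(* Splitting at 3, where exp(-3) <= 1/4, the moment p satisfies
   p <= 9 + (2 p + 18) / 4. *)
Lemma truncated_sq_moment e (M : R) : 0 <= M ->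
  (\int[P]_x (Order.min `|Y e x| M ^+ 2)%:E <= 27%:E)%E.
Proof.
move=> M0; have [ee|ee] := boolP (is_edge e); last first.
  under eq_integral do rewrite Y_nonedge// normr0 min_l// expr0n.
  by rewrite integral_cst_prob lee_fin.
pose g (y : R) := Order.min `|y| M ^+ 2.
have mg : measurable_fun setT g.
  by apply: measurable_funX; exact: measurable_minr.
have g0 y : 0 <= g y by exact: sqr_ge0.
have mgY : measurable_fun setT (fun x => (g (Y e x))%:E).
  by apply/measurable_EFinP; apply: measurableT_comp.
rewrite -[X in (X <= _)%E]/(\int[P]_x (g (Y e x))%:E)%E.
have gM y : g y <= M ^+ 2.
  rewrite /g ler_sqr ?nnegrE ?ge_min ?lexx ?orbT//.
  by rewrite le_min normr_ge0.
(* Truncation makes the moment finite beforehand, so that the inequality [p <= 9 + (2 p + 18) / 4]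
   can be solved for [p], giving 27. *)
have intM : (\int[P]_x (g (Y e x))%:E <= (M ^+ 2)%:E)%E.
  rewrite -[leRHS]integral_cst_prob; apply: ge0_le_integral => //.
    by move=> x _; rewrite lee_fin.
  by move=> x _; rewrite lee_fin.
have int0 : (0 <= \int[P]_x (g (Y e x))%:E)%E.
  by apply: integral_ge0 => x _; rewrite lee_fin.
have intE : (\int[P]_x (g (Y e x))%:E)%E = (fine (\int[P]_x (g (Y e x))%:E))%:E.
  by rewrite fineK// ge0_fin_numE// (le_lt_trans intM)// ltry.
have p0 := fine_ge0 int0.
have mle := measurable_le_edge e 3.
have : (\int[P]_x (g (Y e x))%:E <= 9%:E +
    (expR (-3))%:E * (2%:E * \int[P]_x (g (Y e x))%:E + 18%:E))%E.
  rewrite -[X in (\int[P]_(x in X) _ <= _)%E](setUv [set x | Y e x <= 3]).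
  rewrite ge0_integral_setU//; last 4 first.
  - exact: measurableC.
  - exact: measurable_funTS.
  - by move=> x _; rewrite lee_fin.
  - exact/disj_setPCl.
  apply: leeD.
    apply: (@le_trans _ _ (\int[P]_(x in [set x | (Y e x <= 3)%R]) (cst 9%:E) x)%E).
      apply: ge0_le_integral => //.
      - by move=> x _; rewrite lee_fin.
      - exact: measurable_funTS.
      - move=> x /= Y3; rewrite lee_fin /g.
        have -> : 9 = 3 ^+ 2 :> R by ring.
        rewrite ler_sqr ?nnegrE// ?le_min ?normr_ge0// ge_min.
        by rewrite ger0_norm// Y3.
    rewrite integral_cst// -[leRHS]mule1 lee_pmul2l//.
    exact: probability_le1.
  rewrite (_ : ~` [set x | Y e x <= 3] = [set x | 3 < Y e x]); last first.
    by apply/seteqP; split => x /=; rewrite ltNge => /negP.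
  rewrite (integral_edge_memoryless (g := g))//.
  apply: lee_wpmul2l; first by rewrite lee_fin expR_ge0.
  rewrite -ge0_integralZl_EFin//; last by move=> x _; rewrite lee_fin.
  under [X in (_ <= X + _)%E]eq_integral do rewrite -EFinM.
  rewrite -ge0_integralDcst//; last 2 first.
  - by apply: measurable_funM => //; apply: measurableT_comp.
  - by move=> x; rewrite mulr_ge0.
  apply: ge0_le_integral => //.
  - by move=> x _; rewrite lee_fin.
  - apply/measurable_EFinP; apply: measurableT_comp => //.
    exact: measurable_funD.
  - apply/measurable_EFinP; apply: measurable_funD => //.
    by apply: measurable_funM => //; apply: measurableT_comp.
  move=> x _; rewrite lee_fin /g !ger0_norm ?addr_ge0//.
  have : Order.min (Y e x + 3) M <= Order.min (Y e x) M + 3.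
    by rewrite addr_minl le_min2// lerDl.
  have : 0 <= Order.min (Y e x + 3) M by rewrite le_min addr_ge0.
  (* This square gives [(v + 3)^2 <= 2 v^2 + 18] for the truncated weight [v]. *)
  have := sqr_ge0 (Order.min (Y e x) M - 3).
  by set u := Order.min _ _; set v := Order.min _ _; nra.
rewrite intE -!EFinM -!EFinD !lee_fin.
have : expR (- 3) * 4 <= 1 :> R.
  rewrite expRN mulrC ler_pdivrMr ?expR_gt0// mul1r.
  by apply: le_trans (expR_ge1Dx 3); lra.
have := expR_gt0 (- 3 : R).
by move: p0; set p := fine _; set q := expR _; nra.
Qed.

Lemma sq_moment e : (\int[P]_x (Y e x ^+ 2)%:E <= 27%:E)%E.
Proof.
pose g (k : nat) x := (Order.min `|Y e x| k%:R ^+ 2)%:E.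
have mg k : measurable_fun setT (g k).
  apply/measurable_EFinP; apply: measurable_funX; apply: measurable_minr => //.
  exact: measurableT_comp.
have gn x : setT x -> nondecreasing_seq (g ^~ x).
  move=> _ k l kl; rewrite lee_fin ler_sqr ?nnegrE ?le_min ?normr_ge0//=.
  by rewrite ge_min lexx ge_min ler_nat kl orbT.
have -> : (\int[P]_x (Y e x ^+ 2)%:E = \int[P]_x limn (g ^~ x))%E.
  apply: eq_integral => x _; apply/esym/lim_near_cst => //.
  exists (Num.truncn `|Y e x|).+1 => // k /= kY; rewrite /g min_l.
    by rewrite ger0_norm.
  by apply/ltW/(lt_le_trans (truncnS_gt _)); rewrite ler_nat.
have g0 k x : setT x -> (0 <= g k x)%E by move=> _; rewrite lee_fin sqr_ge0.
rewrite monotone_convergence//; apply: lime_le.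
  by apply: cvgP; apply: cvg_monotone_convergence => //.
by apply: nearW => k; exact: truncated_sq_moment.
Qed.

(** [A] is arbitrary, so no independence is available; instead [y <= a + y^2 / a], with [a] left
    free to balance the probability of [A] against the second moment. *)
Lemma integral_edge_restr A e a p : measurable A -> 0 < a ->
  (P A <= p%:E)%E -> (\int[P]_(x in A) (Y e x)%:E <= (a * p + 27 / a)%:E)%E.
Proof.
move=> mA a0 PA.
have mY2 : measurable_fun setT (fun x => ((Y e x ^+ 2) / a)%:E).
  apply/measurable_EFinP; apply: measurable_funM => //.
  exact: measurable_funX.
have Y20 x : 0 <= Y e x ^+ 2 / a by rewrite divr_ge0 ?sqr_ge0// ltW.
apply: (@le_trans _ _ (\int[P]_(x in A) (a%:E + ((Y e x ^+ 2) / a)%:E))%E).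
  apply: ge0_le_integral => //.
  - by move=> x _; rewrite lee_fin.
  - by apply: measurable_funTS; exact/measurable_EFinP.
  - by apply: measurable_funTS; apply: emeasurable_funD.
  - move=> x _; rewrite -EFinD lee_fin -(ler_pM2r a0) mulrDl divfK ?gt_eqF//.
    by have := sqr_ge0 (Y e x - a); nra.
rewrite ge0_integralD//; last 3 first.
- by move=> x _; rewrite lee_fin ltW.
- by move=> x _; rewrite lee_fin.
- exact: measurable_funTS.
rewrite EFinD; apply: leeD.
  rewrite [leLHS](integral_cst P mA a%:E) EFinM lee_pmul2l//.
apply: (@le_trans _ _ (\int[P]_x ((Y e x ^+ 2) / a)%:E)%E).
  by apply: ge0_subset_integral => //; move=> x _; rewrite lee_fin.
under eq_integral do rewrite mulrC EFinM.
rewrite ge0_integralZl_EFin//.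
- rewrite [X in (_ <= X%:E)%E]mulrC EFinM lee_pmul2l ?lte_fin ?invr_gt0//.
  exact: sq_moment.
- by move=> x _; rewrite lee_fin sqr_ge0.
- by apply/measurable_EFinP; exact: measurable_funX.
- by rewrite invr_ge0 ltW.
Qed.

(** The crude bound of the cost by [n] times the sum of the [n^2] weights explains the cube; [p]
    will be a large negative power of [n]. *)
Lemma integral_conn_cost_restr (U : {set 'I_n}) A a p : (0 < #|U|)%N ->
  measurable A -> 0 < a -> (P A <= p%:E)%E ->
  (\int[P]_(x in A) (conn_cost (Y ^~ x) U)%:E <=
   (n%:R ^+ 3 * (a * p + 27 / a))%:E)%E.
Proof.
move=> U0 mA a0 PA.
apply: (@le_trans _ _
    (\int[P]_(x in A) (\sum_(e <- index_enum ('I_n * 'I_n)%type) (n%:R * Y e x)%:E))%E).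
  apply: ge0_le_integral => //.
  - by move=> x _; rewrite lee_fin conn_cost_ge0.
  - apply: measurable_funTS; apply/measurable_EFinP.
    exact: measurable_conn_cost.
  - apply: measurable_funTS; apply: emeasurable_sum => e.
    by apply/measurable_EFinP; apply: measurable_funM.
  - move=> x _; rewrite sumEFin lee_fin -mulr_sumr.
    exact: conn_cost_le_sum.
rewrite ge0_integral_sum//; last 2 first.
- move=> e; apply: measurable_funTS.
  by apply/measurable_EFinP; apply: measurable_funM.
- by move=> e x _; rewrite lee_fin mulr_ge0.
apply: (@le_trans _ _ (\sum_(e : 'I_n * 'I_n) (n%:R * (a * p + 27 / a))%:E)%E).
  apply: lee_sum => e _; under eq_integral do rewrite EFinM.
  rewrite ge0_integralZl_EFin//.
  - rewrite EFinM; apply: lee_wpmul2l; first by rewrite lee_fin.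
    exact: integral_edge_restr.
  - by move=> x _; rewrite lee_fin.
  - by apply: measurable_funTS; exact/measurable_EFinP.
rewrite sumEFin sumr_const card_prod card_ord lee_fin -[leLHS]mulr_natl natrM.
by rewrite !mulrA -expr2 -exprSr.
Qed.

Lemma mean_conn_cost (U : {set 'I_n}) : (0 < #|U|)%N ->
  (\int[P]_x (conn_cost (Y ^~ x) U)%:E <=
   (\sum_(#|U| <= i < n) i%:R^-1)%:E)%E.
Proof.
have [k] := ubnP (n - #|U|); elim: k U => // k IHk U.
rewrite ltnS => Uk U0.
have mC := measurable_conn_cost mY U0.
have C0 x : 0 <= conn_cost (Y ^~ x) U by exact: conn_cost_ge0.
have [nU|Un] := leqP n #|U|.
  rewrite big_geq//; have -> : U = [set: 'I_n]%SET.
    by apply/eqP; rewrite eqEcard finset.subsetT cardsT card_ord.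
  under eq_integral do rewrite conn_cost_setT//.
  by rewrite integral_cst_prob.
have int0 : (0 <= \int[P]_x (conn_cost (Y ^~ x) U)%:E)%E.
  by apply: integral_ge0 => x _; rewrite lee_fin.
(* Finiteness is needed before the inequality can be solved for [p]; it comes from the previous
   lemma on the whole space. *)
have intE : (\int[P]_x (conn_cost (Y ^~ x) U)%:E)%E =
    (fine (\int[P]_x (conn_cost (Y ^~ x) U)%:E))%:E.
  rewrite fineK// ge0_fin_numE//.
  apply: le_lt_trans (integral_conn_cost_restr (a := 1) (p := 1) U0 _ _ _) _ => //.
    by rewrite probability_setT.
  exact: ltry.
have p0 := fine_ge0 int0.
rewrite big_ltn//; set B := \sum_(_ <= _ < _) _.
have B0 : 0 <= B by apply: sumr_ge0 => i _; rewrite invr_ge0.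
rewrite intE lee_fin; move: p0 intE; set p := fine _ => p0 intE.
have nU0 : 0 < (n - #|U|)%:R :> R by rewrite ltr0n subn_gt0.
have U0R : 0 < #|U|%:R :> R by rewrite ltr0n.
pose m : R := #|cut_edges U|%:R; pose N : R := (n - #|U|)%:R.
have mE : m = #|U|%:R * N by rewrite /m card_cut natrM.
have m0 : 0 < m by rewrite mE mulr_gt0.
(* In the limit, [m p <= N + m B], and [N / m] is the new summand [1 / #|U|]. [G] must be
   nonnegative on all reals, hence the absolute values. *)
have /ler_limit_step : forall h, 0 < h ->
    p <= expR (- (m * h)) * (p + N * h) + h * (m * B + m * N * h).
  move=> h h0; rewrite -lee_fin -intE.
  have Nh0 : 0 <= N * h by rewrite mulr_ge0 ?ltW.
  under eq_integral do rewrite -[conn_cost _ _]ger0_norm//.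
  apply: le_trans (integral_cost_step (h := h) (B := B + N * h)
    (G := fun c => `|c|) (G' := fun c => `|c| + N * h) _ _ _ _ _ _ _ _ _) _ => //.
  - exact: ltW.
  - exact: measurable_funD.
  - by move=> c; rewrite addr_ge0.
  - move=> c c' c'0 /andP[c'c cc']; rewrite !ger0_norm//.
    exact: le_trans c'c.
  - by rewrite addr_ge0.
  - move=> v vU.
    have vU0 : (0 < #|v |: U|)%N by rewrite card_setU1_notin.
    under eq_integral do rewrite ger0_norm ?conn_cost_ge0//.
    rewrite ge0_integralDcst//; last 2 first.
    + exact: measurable_conn_cost.
    + by move=> x; exact: conn_cost_ge0.
    rewrite EFinD; apply: leeD => //; rewrite /B -(card_setU1_notin vU).
    apply: IHk => //.
    by rewrite card_setU1_notin// subnS -ltnS prednK ?subn_gt0.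
  rewrite EFinD; apply: leeD; last first.
    by rewrite lee_fin -/m; nra.
  under eq_integral do rewrite ger0_norm ?addr_ge0//.
  by rewrite ge0_integralDcst// intE.
move=> /(_ p0 m0 (ltW nU0) (mulr_ge0 (ltW m0) B0)
  (mulr_ge0 (ltW m0) (ltW nU0))) H.
rewrite -(ler_pM2l m0) mulrDr; apply: le_trans H _.
by rewrite lerD2r mE mulrAC divff ?gt_eqF// mul1r.
Qed.

End ExpWeights.

(** * From the given weights to nonnegative ones *)

Section Exponential.
Context {R : realType}.

Lemma exponential_prob_lt0 : exponential_prob (1 : R) `]-oo, 0[ = 0%E.
Proof.
apply: integral0_eq => x; rewrite /= in_itv/= => x0.
by rewrite lt0_exponential_pdf.
Qed.

Lemma exponential_prob_itvNyc (a : R) : 0 <= a ->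
  exponential_prob (1 : R) `]-oo, a] = (1 - expR (- a))%:E.
Proof.
move=> a0; rewrite (_ : [set` `]-oo, a]] = `]-oo, 0[ `|` `[0, a]); last first.
  apply/seteqP; split => x /=; rewrite !in_itv/=.
    by move=> xa; case: (ltP x 0) => x0; [left|right; rewrite xa].
  by move=> [x0|/andP[]//]; apply: le_trans a0; exact: ltW.
rewrite /exponential_prob ge0_integral_setU//=; last 3 first.
- apply: measurable_funTS; apply/measurable_EFinP.
  exact: measurable_exponential_pdf.
- by move=> x _; rewrite lee_fin exponential_pdf_ge0.
- apply/disj_setPS => x [] /=; rewrite !in_itv/= => x0 /andP[+ _].
  by rewrite leNgt x0.
rewrite [X in (X + _)%E]exponential_prob_lt0 add0e.
move: a0; rewrite le_eqVlt => /predU1P[<-|a0].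
  by rewrite set_itv1 integral_set1 oppr0 expR0 subrr.
by rewrite [LHS]exponential_prob_itv0c// mulN1r EFinB.
Qed.

End Exponential.

Section PositiveWeights.
Context {R : realType} {n : nat} d (T : measurableType d).
Variables (P : probability T R) (X : 'I_n * 'I_n -> {RV P >-> R}).
Hypothesis iidX : iid_exp1 X.

(* [iid_exp1] says nothing about [X e] when [e] is not an edge, and allows
   negative values on a null set. *)
Definition pos_weight (e : 'I_n * 'I_n) (x : T) : R :=
  if is_edge e then Order.max 0 (X e x) else 0.

Lemma measurable_pos_weight e : measurable_fun setT (pos_weight e).
Proof.
by rewrite /pos_weight; case: is_edge => //; exact: measurable_maxr.
Qed.

Lemma pos_weight_ge0 e x : 0 <= pos_weight e x.
Proof. by rewrite /pos_weight; case: ifP => // _; rewrite le_max lexx. Qed.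

Lemma pos_weight_nonedge e x : ~~ is_edge e -> pos_weight e x = 0.
Proof. by rewrite /pos_weight => /negPf ->. Qed.

Lemma ae_pos_weight :
  {ae P, forall x, forall e, is_edge e -> X e x = pos_weight e x}.
Proof.
apply: filter_forall => e; have [ee|] := boolP (is_edge e); last first.
  by move=> ee; apply: filterE.
exists (X e @^-1` `]-oo, 0[); split.
- by rewrite -[X in measurable X]setTI; exact: measurable_funP.
- by rewrite iidX.1// exponential_prob_lt0.
- move=> x /= /not_implyP[_]; rewrite /pos_weight ee in_itv/= => Xx.
  by rewrite ltNge; apply/negP => X0; apply: Xx; rewrite max_r.
Qed.

Lemma pos_weight_survival e (a : R) : is_edge e ->
  P (X e @^-1` [set y | a < Order.max 0 y]) = (survival e a)%:E.
Proof.
move=> ee; rewrite /survival ee; have [a0|a0] := ltP a 0.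
  rewrite (_ : _ @^-1` _ = setT); first by rewrite probability_setT oppr0 expR0.
  by apply/seteqP; split => x //= _; rewrite lt_max a0.
rewrite (_ : _ @^-1` _ = ~` (X e @^-1` `]-oo, a])); last first.
  apply/seteqP; split => x /=; rewrite in_itv/= lt_max ltNge a0 /= ltNge => /negP//.
have mXa : measurable (X e @^-1` `]-oo, a]).
  by rewrite -[X in measurable X]setTI; exact: measurable_funP.
rewrite probability_setC// iidX.1// exponential_prob_itvNyc// -EFinB.
by rewrite opprB addrC subrK.
Qed.

Lemma pos_weight_ray a :
  P (ray pos_weight a) = (\prod_e survival e (a e))%:E.
Proof.
(* A nonedge with [a e >= 0] makes both sides 0. Otherwise the conditions at nonedges always hold
   and independence is applied to the set of all edges. *)
have [[e /andP[ee ae]]|H] :=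
    pselect (exists e, ~~ is_edge e && (0 <= a e)).
  rewrite (bigD1 e)//= {1}/survival (negPf ee) ltNge ae mul0r.
  rewrite (_ : ray _ _ = set0) ?measure0// -subset0 => x /(_ e).
  by rewrite pos_weight_nonedge// ltNge ae.
have {}H e : ~~ is_edge e -> a e < 0.
  by move=> ee; rewrite ltNge; apply/negP => ae; apply: H; exists e; rewrite ee.
pose S := [set e : 'I_n * 'I_n | is_edge e]%SET.
pose B e := [set y : R | a e < Order.max 0 y].
have mB e : measurable (B e).
  rewrite (_ : B e = (fun y => Order.max 0 y) @^-1` `]a e, +oo[).
    rewrite -[X in measurable X]setTI; apply: measurable_maxr => //.
  by apply/seteqP; split => y /=; rewrite in_itv/= andbT.
have -> : ray pos_weight a = [set x | forall e, e \in S -> B e (X e x)].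
  apply/seteqP; split => x /= Hx e.
    by rewrite inE => ee; have := Hx e; rewrite /pos_weight ee.
  have := Hx e; rewrite inE /pos_weight /B /=.
  by case: ifPn => [_ /(_ isT)//|/H].
rewrite iidX.2//; last by move=> e; rewrite inE.
rewrite (eq_bigr (fun e => (survival e (a e))%:E)); last first.
  by move=> e; rewrite inE => ee; exact: pos_weight_survival.
rewrite prodEFin; congr EFin; rewrite big_mkcond; apply: eq_bigr => e _.
rewrite inE; case: ifPn => // ee.
by rewrite /survival (negPf ee) H.
Qed.

End PositiveWeights.

(** * Numerical estimates *)

Section Estimates.
Context {R : realType}.

Lemma sum_inv_le_ln (k n : nat) : (0 < k)%N -> (k < n)%N ->
  \sum_(k <= i < n) i%:R^-1 <= 1 + ln (n%:R / k%:R) :> R.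
Proof.
move=> k0; case: n => // m; rewrite ltnS => km.
apply: (@le_trans _ _ (1 + (ln m%:R - ln k%:R))); last first.
  have kR : (k%:R : R) \is Num.pos by rewrite posrE ltr0n.
  rewrite lerD2l lnM ?posrE ?ltr0n ?invr_gt0 ?ltr0n// lnV// lerD2r ler_ln ?posrE ?ltr0n//.
    by rewrite ler_nat.
  exact: leq_trans km.
elim: m km => [|m IHm]; first by rewrite leqn0 => /eqP k00; rewrite k00 in k0.
rewrite leq_eqVlt => /predU1P[<-|]; first by rewrite big_nat1 subrr addr0 invf_le1 ?ler1n ?ltr0n.
rewrite ltnS => km; rewrite big_nat_recr/=; last exact: leqW.
have m0 : (0 < m)%N by exact: leq_trans km.
(* The bound [ln (1 - x) <= -x] at [x = 1 / (m + 1)], which sums telescopically. *)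
have step : (m.+1%:R : R)^-1 <= ln m.+1%:R - ln m%:R.
  have : ln (1 + (- m.+1%:R^-1)) <= - m.+1%:R^-1 :> R.
    by apply: le_ln1Dx; rewrite ltrN2 invf_lt1 ?ltr0n// ltr1n ltnS.
  have -> : 1 + - m.+1%:R^-1 = m%:R / m.+1%:R :> R.
    rewrite -[X in X + _](@divff _ m.+1%:R) ?pnatr_eq0// -mulN1r -mulrDl.
    by rewrite -natr1 addrK.
  rewrite lnM ?posrE ?ltr0n ?invr_gt0 ?ltr0n// lnV ?posrE ?ltr0n//.
  by move: (ln _) (ln _) (_^-1) => x y z; lra.
have := IHm km; move: step; move: (ln _) (ln _) (_^-1) => x y z; lra.
Qed.

(** Both sides equal (n-1)! (k+N-1)! / ((k-1)! (n+N-1)!). The exchange leaves [N] factors, so the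
    Laplace bound becomes a power with exponent theta. *)
Lemma prod_rising (k n N : nat) : (0 < k)%N -> (k <= n)%N ->
  \prod_(k <= i < n) (i%:R / (i%:R + N%:R)) =
  \prod_(j < N) ((k + j)%:R / (n + j)%:R) :> R.
Proof.
move=> k0 /subnK <-; elim: (n - k)%N => [|m IHm].
  rewrite add0n big_geq// big1// => j _; rewrite divff// pnatr_eq0.
  by rewrite -lt0n addn_gt0 k0.
set q := (m + k)%N in IHm *; have q0 : (0 < q)%N by rewrite addn_gt0 k0 orbT.
have -> : (m.+1 + k)%N = q.+1 by [].
rewrite big_nat_recr ?leq_addl//= IHm !big_split /= -mulrA; congr (_ * _).
rewrite !prodfV.
have E : q%:R * \prod_(j < N) (q.+1 + j)%:R =
    \prod_(j < N) (q + j)%:R * (q + N)%:R :> R.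
  rewrite -(big_ord_recr N (fun j => (q + j)%:R))/= big_ord_recl addn0.
  by congr (_ * _); apply: eq_bigr => j _; rewrite /= ?/bump ?add1n addSnnS.
have p1 : \prod_(j < N) (q.+1 + j)%:R != 0 :> R.
  by apply/prodf_neq0 => j _; rewrite pnatr_eq0.
have p2 : \prod_(j < N) (q + j)%:R != 0 :> R.
  by apply/prodf_neq0 => j _; rewrite pnatr_eq0 -lt0n addn_gt0 q0.
have p3 : (q + N)%:R != 0 :> R by rewrite pnatr_eq0 -lt0n addn_gt0 q0.
rewrite -natrD; apply: (mulfI p2); rewrite !mulrA divff// mul1r.
apply: (mulIf p3); rewrite divfK// mulrAC -E mulrK//.
by rewrite unitfE.
Qed.

Lemma prod_rising_le (k n s : nat) : (0 < k)%N -> (k <= n)%N ->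
  \prod_(k <= i < n) (i%:R / (i%:R + (s * k)%:R)) <=
  ((s.+1 * k)%:R / n%:R) ^+ (s * k) :> R.
Proof.
move=> k0 kn; rewrite prod_rising//.
rewrite -[X in _ ^+ X](card_ord (s * k)) -prodr_const.
apply: ler_prod => j _; rewrite divr_ge0//=.
have n0 : (0 < n)%N by exact: leq_trans kn.
apply: ler_pM => //.
  by rewrite ler_nat mulSn leq_add2l ltnW.
by rewrite lef_pV2 ?posrE ?ltr0n ?addn_gt0 ?n0// ler_nat leq_addr.
Qed.

Lemma bin_le_expR (n k : nat) : (0 < k)%N -> (k <= n)%N ->
  'C(n, k)%:R <= (expR 1 * (n%:R / k%:R)) ^+ k :> R.
Proof.
move=> k0 kn; have n0 : (0 < n)%N by exact: leq_trans kn.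
have kR : 0 < k%:R :> R by rewrite ltr0n.
have nR : 0 < n%:R :> R by rewrite ltr0n.
(* One term of the binomial expansion of [(1 + x)^n <= exp (n x)], with [x] chosen so that
   [n x = k]. *)
pose x : R := k%:R / n%:R; have x0 : 0 < x by rewrite divr_gt0.
have H1 : 'C(n, k)%:R * x ^+ k <= (1 + x) ^+ n.
  rewrite exprDn (bigD1 (Ordinal (kn : (k < n.+1)%N)))//= expr1n mul1r.
  rewrite mulr_natl lerDl sumr_ge0// => i _.
  by rewrite expr1n mul1r mulrn_wge0// exprn_ge0// ltW.
have H2 : (1 + x) ^+ n <= expR 1 ^+ k.
  apply: (@le_trans _ _ (expR x ^+ n)).
    by rewrite lerXn2r ?nnegrE ?expR_ge0 ?expR_ge1Dx// addr_ge0// ltW.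
  rewrite -!expRM_natl ler_expR /x mulr1 mulrC divfK// gt_eqF//.
have -> : n%:R / k%:R = x^-1 :> R by rewrite invf_div.
rewrite exprMn -(ler_pM2r (exprn_gt0 k x0)) -mulrA -exprMn mulVf ?gt_eqF//.
by rewrite expr1n mulr1 (le_trans H1).
Qed.

(* Chernoff at theta = s K against the union over all sets of size K; the
   exponent is linear in l once s (D, eps) is fixed and l is large. *)
Lemma union_bound_numeric (n k b s D : nat) (eps : R) :
  let l := ln (n%:R / k%:R) in
  0 < eps <= 1 -> (0 < k)%N -> (2 * k <= n)%N ->
  1 <= l -> 2 * (D%:R + 2) <= s%:R * eps ->
  1 + l <= b%:R <= 2 + l ->
  48 * s.+1%:R <= eps ^+ 2 * l ->
  (k * b <= n)%N /\
  'C(n, k * b)%:R * (expR ((s * (k * b))%:R * ((1 - eps) * l)) *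
    ((s.+1 * (k * b))%:R / n%:R) ^+ (s * (k * b))) <= n%:R ^- D.
Proof.
move=> l /andP[e0 e1] k0 kn l1 seps /andP[b1 b2] lbig.
have n0 : (0 < n)%N by lia.
have kR : 0 < k%:R :> R by rewrite ltr0n.
have nR : 0 < n%:R :> R by rewrite ltr0n.
have s0 : 0 <= s%:R :> R by [].
have lE : expR l = n%:R / k%:R by rewrite lnK// posrE divr_gt0.
(* With [y = eps l / 4], [exp (2 y) >= (1 + y)^2 >= eps^2 l^2 / 16], while [b <= 3 l]; this is the
   origin of 48 = 3 * 16. *)
have sb : s.+1%:R * b%:R <= expR (eps * l / 2).
  apply: (@le_trans _ _ ((1 + eps * l / 4) ^+ 2)).
    apply: (@le_trans _ _ (s.+1%:R * (3 * l))).
      by rewrite ler_pM2l ?ltr0n//; lra.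
    have H : 48 * s.+1%:R * l <= eps ^+ 2 * l * l by rewrite ler_pM2r//; lra.
    have : 0 <= eps * l by rewrite mulr_ge0//; lra.
    by move: H; set S := s.+1%:R; rewrite !expr2; nra.
  have -> : eps * l / 2 = 2%:R * (eps * l / 4) by lra.
  rewrite expRM_natl lerXn2r ?nnegrE ?expR_ge0 ?expR_ge1Dx// addr_ge0//.
  by rewrite divr_ge0// mulr_ge0//; lra.
have bl : b%:R <= n%:R / k%:R :> R.
  rewrite -lE; apply: (@le_trans _ _ (s.+1%:R * b%:R)).
    by rewrite ler_peMl// ler1n.
  apply: le_trans sb _; rewrite ler_expR; nra.
have b0 : (0 < b)%N by rewrite -(ltr0n R); lra.
have kbn : (k * b <= n)%N.
  by rewrite -(ler_nat R) natrM mulrC -ler_pdivlMr.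
have K0 : (0 < k * b)%N by rewrite muln_gt0 k0.
split => //; set K := (k * b)%N in K0 kbn *.
have KR : K%:R = k%:R * b%:R :> R by rewrite /K natrM.
apply: (@le_trans _ _ ((expR 1 * (n%:R / K%:R)) ^+ K *
   (expR ((s * K)%:R * ((1 - eps) * l)) * ((s.+1 * K)%:R / n%:R) ^+ (s * K)))).
  rewrite ler_wpM2r ?bin_le_expR// mulr_ge0 ?expR_ge0// exprn_ge0// divr_ge0//.
rewrite expRM_natl -exprMn exprM -exprMn.
(* Since [K / n = b exp (-l)], the left side is [(s + 1) b exp (- eps l)], and half of the exponent
   pays for the prefactor. *)
have step1 : expR ((1 - eps) * l) * ((s.+1 * K)%:R / n%:R) <= expR (- (eps * l / 2)).
  have -> : (s.+1 * K)%:R / n%:R = s.+1%:R * b%:R * expR (- l) :> R.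
    by rewrite expRN lE invf_div natrM KR; field; rewrite !gt_eqF.
  rewrite mulrCA -expRD.
  apply: (@le_trans _ _ (expR (eps * l / 2) * expR ((1 - eps) * l - l))).
    by rewrite ler_wpM2r// expR_ge0.
  by rewrite -expRD ler_expR; lra.
(* The binomial coefficient contributes at most [exp (1 + l) <= exp (2 l)] per element; the 2 in
   [D + 2] pays for it. *)
have step2 : expR 1 * (n%:R / K%:R) *
    (expR ((1 - eps) * l) * ((s.+1 * K)%:R / n%:R)) ^+ s <= expR (- (D%:R * l)).
  apply: (@le_trans _ _ (expR 1 * expR l * expR (- (eps * l / 2)) ^+ s)).
    apply: ler_pM.
    - by rewrite mulr_ge0 ?expR_ge0// divr_ge0.
    - by rewrite exprn_ge0// mulr_ge0 ?expR_ge0// divr_ge0.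
    - rewrite ler_pM2l ?expR_gt0// lE KR invfM mulrA ler_piMr ?divr_ge0//.
      by rewrite invf_le1 ?ltr0n// ler1n.
    - rewrite lerXn2r ?nnegrE ?expR_ge0// mulr_ge0 ?expR_ge0// divr_ge0//.
  rewrite -expRM_natl -!expRD ler_expR.
  have : 2 * (D%:R + 2) * l <= s%:R * eps * l by rewrite ler_pM2r//; lra.
  by lra.
apply: (@le_trans _ _ (expR (- (D%:R * l)) ^+ K)).
  by rewrite lerXn2r// nnegrE ?expR_ge0.
(* From [k <= 2^(k-1)] and [n / k >= 2]. It converts decay in [exp (l K)] into decay in [n],
   whatever the size of [k]. *)
have nk : n%:R <= expR l ^+ k.
  rewrite lE; have r2 : 2 <= n%:R / k%:R :> R.
    by rewrite ler_pdivlMr// -natrM ler_nat.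
  apply: (@le_trans _ _ (n%:R / k%:R * 2 ^+ k.-1)).
    rewrite mulrAC ler_pdivlMr// ler_pM2l// -natrX ler_nat.
    by have := ltn_expl k.-1 (isT : (1 < 2)%N); rewrite prednK.
  rewrite -[X in _ <= _ ^+ X](prednK k0) exprS ler_pM2l ?divr_gt0//.
  by rewrite lerXn2r ?nnegrE// (le_trans _ r2).
rewrite -mulrN mulrC expRM_natr expRN -exprM exprVn.
rewrite lef_pV2 ?posrE ?exprn_gt0 ?expR_gt0//.
apply: (@le_trans _ _ ((expR l ^+ k) ^+ D)).
  by rewrite lerXn2r ?nnegrE ?exprn_ge0 ?expR_ge0.
rewrite -exprM ler_weXn2l//; first by rewrite -expR0 ler_expR; lra.
by rewrite mulnC leq_mul2l /K leq_pmulr ?orbT.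
Qed.

End Estimates.

(** * Cheap sets of facilities *)

Lemma measure_bigsetU_le d (T : measurableType d) (R : realType)
    (m : {measure set T -> \bar R}) (I : Type) (s : seq I) (p : pred I)
    (A : I -> set T) :
  (forall i, measurable (A i)) ->
  (m (\big[setU/set0]_(i <- s | p i) A i) <= \sum_(i <- s | p i) m (A i))%E.
Proof.
move=> mA; elim: s => [|i s IHs]; first by rewrite !big_nil measure0.
rewrite !big_cons; case: ifP => // _.
apply: le_trans (measureU2 _ _ _) _ => //; first exact: bigsetU_measurable.
exact: leeD2l.
Qed.

Lemma exists_superset_card n (U : {set 'I_n}) K : (#|U| <= K)%N -> (K <= n)%N ->
  exists2 U' : {set 'I_n}, U \subset U' & #|U'| = K.
Proof.
have [k] := ubnP (K - #|U|); elim: k U => // k IHk U.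
rewrite ltnS => Uk UK Kn; have [KU|KU] := leqP K #|U|.
  by exists U => //; apply/eqP; rewrite eqn_leq UK.
have [v vU] : exists v, v \notin U.
  apply/existsP; rewrite -negb_forall; apply/negP => /forallP UT.
  have : #|U| = n.
    by rewrite -[RHS]card_ord; apply: eq_card => v; rewrite UT.
  by move: KU Kn => /leq_trans /[apply]; rewrite ltn_neqAle => /andP[/eqP].
have vUE : #|v |: U| = #|U|.+1 by rewrite cardsU1 vU.
have [||//|U' vU' U'K] := IHk (v |: U).
- by rewrite vUE subnS -ltnS prednK ?subn_gt0.
- by rewrite vUE.
by exists U' => //; apply: fintype.subset_trans vU'; exact: finset.subsetUr.
Qed.

Section Tail.
Context {R : realType} {n : nat} d (T : measurableType d).
Variables (P : probability T R) (X : 'I_n * 'I_n -> {RV P >-> R}).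
Hypothesis iidX : iid_exp1 X.

Local Notation Y := (pos_weight X).

Lemma measurable_cost_le (U : {set 'I_n}) tau : (0 < #|U|)%N ->
  measurable [set x | conn_cost (Y ^~ x) U <= tau].
Proof.
move=> U0; rewrite (_ : [set x | _] = (fun x => conn_cost (Y ^~ x) U) @^-1` `]-oo, tau]).
  rewrite -[X in measurable X]setTI.
  exact: (measurable_conn_cost (measurable_pos_weight X) U0).
by apply/seteqP; split => x /=; rewrite in_itv.
Qed.

(** Markov's inequality for [exp (- theta C)]. *)
Lemma lower_tail theta tau (U : {set 'I_n}) : 0 <= theta -> (0 < #|U|)%N ->
  (P [set x | (conn_cost (Y ^~ x) U <= tau)%R] <=
   (expR (theta * tau) * \prod_(#|U| <= i < n) (i%:R / (i%:R + theta)))%:E)%E.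
Proof.
move=> th0 U0; have mA := measurable_cost_le tau U0.
have mC := measurable_conn_cost (measurable_pos_weight X) U0.
set A := [set x | _].
have mG : measurable_fun setT
    (fun x => (expR (- (theta * conn_cost (Y ^~ x) U)))%:E).
  apply/measurable_EFinP; apply: (measurableT_comp (f := expR)) => //.
  rewrite (_ : (fun x => _) = (fun x => - theta * conn_cost (Y ^~ x) U)).
    exact: measurable_funM.
  by apply/funext => c; rewrite mulNr.
apply: (@le_trans _ _ (\int[P]_x ((expR (theta * tau))%:E *
    (expR (- (theta * conn_cost (Y ^~ x) U)))%:E))%E).
  rewrite -[in leLHS](setIT A) -integral_indic//.
  apply: ge0_le_integral => //.
  - exact/measurable_EFinP.
  - exact: measurable_funeM.
  move=> x _; rewrite -EFinM lee_fin -expRD indicE.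
  have [xA|_] := boolP (x \in A); last exact: expR_ge0.
  rewrite -[leLHS]expR0 ler_expR subr_ge0 ler_wpM2l//.
  by move: xA; rewrite inE.
rewrite ge0_integralZl_EFin//.
rewrite EFinM lee_wpmul2l// ?lee_fin ?expR_ge0//.
apply: laplace_conn_cost => //.
- exact: measurable_pos_weight.
- exact: pos_weight_ge0.
- exact: pos_weight_ray.
Qed.

(** Sets of size exactly [K] suffice: a smaller set extends to one of size [K], and adding
    facilities only lowers the connection cost. *)
Definition cheap_set (K : nat) (tau : R) : set T :=
  \big[setU/set0]_(U : {set 'I_n} | #|U| == K)
    [set x | conn_cost (Y ^~ x) U <= tau].

Lemma measurable_cheap_set K tau : (0 < K)%N -> measurable (cheap_set K tau).
Proof.
move=> K0; apply: bigsetU_measurable => U /eqP UK.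
by apply: measurable_cost_le; rewrite UK.
Qed.

Lemma notin_cheap_set K tau x (U : {set 'I_n}) : (K <= n)%N ->
  ~ cheap_set K tau x -> (0 < #|U| <= K)%N -> tau < conn_cost (Y ^~ x) U.
Proof.
move=> Kn xK /andP[U0 UK]; have [U' UU' U'K] := exists_superset_card UK Kn.
apply: lt_le_trans (conn_costS _ U0 UU'); last by move=> e; exact: pos_weight_ge0.
rewrite ltNge; apply/negP => H; apply: xK.
by rewrite /cheap_set (bigD1 U') ?U'K//=; left.
Qed.

Lemma prob_cheap_set (K s : nat) tau : (0 < K)%N -> (K <= n)%N ->
  (P (cheap_set K tau) <=
   ('C(n, K)%:R * (expR ((s * K)%:R * tau) *
     ((s.+1 * K)%:R / n%:R) ^+ (s * K)))%:E)%E.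
Proof.
move=> K0 Kn.
(* The union bound asks for measurability at every index, including the empty set, to which
   [measurable_cost_le] does not apply. *)
pose A (U : {set 'I_n}) :=
  if (0 < #|U|)%N then [set x | conn_cost (Y ^~ x) U <= tau] else set0.
have -> : cheap_set K tau = \big[setU/set0]_(U : {set 'I_n} | #|U| == K) A U.
  by apply: eq_bigr => U /eqP UK; rewrite /A UK K0.
apply: le_trans (measure_bigsetU_le _ _ _ _) _.
  by move=> U; rewrite /A; case: ltnP => // U0; exact: measurable_cost_le.
apply: (@le_trans _ _ (\sum_(U : {set 'I_n} | #|U| == K)
    (expR ((s * K)%:R * tau) * ((s.+1 * K)%:R / n%:R) ^+ (s * K))%:E)%E).
  apply: lee_sum => U /eqP UK; rewrite /A UK K0.
  apply: le_trans (lower_tail (theta := (s * K)%:R) _ _ _) _; rewrite ?UK//.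
  rewrite lee_fin ler_pM2l ?expR_gt0//; exact: prod_rising_le.
rewrite sumEFin lee_fin sumr_const -[leLHS]mulr_natl -[X in 'C(X, _)]card_ord.
by rewrite -card_draws cardsE lexx.
Qed.

End Tail.

(** * Opening costs and the threshold kappa *)

Section OpeningCosts.
Context {R : realType} {n : nat}.
Variable f : 'I_n -> R.
Hypothesis f_gt0 : forall i, 0 < f i.
Hypothesis f_sorted : forall i j : 'I_n, (i <= j)%N -> f i <= f j.
Variable i0 : 'I_n.
Hypothesis i0E : nat_of_ord i0 = 0%N.

Lemma kappa_attained : exists2 k : 'I_n, k.+1 = kappa f &
  (nat_of_ord k == 0)%N || (f k < k%:R^-1).
Proof.
pose p (k : 'I_n) := (nat_of_ord k == 0)%N || (f k < k%:R^-1).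
have [|k pk kE] := eq_bigmax_cond (A := p) (fun k : 'I_n => k.+1).
  by apply/card_gt0P; exists i0; rewrite unfold_in /p i0E.
by exists k => //; rewrite /kappa -[RHS]kE.
Qed.

Lemma kappa_gt0 : (0 < kappa f)%N.
Proof. by have [k <-] := kappa_attained. Qed.

Lemma kappa_le_n : (kappa f <= n)%N.
Proof. by have [k <-] := kappa_attained. Qed.

Lemma kappa_out (k : 'I_n) : (kappa f <= k)%N -> k%:R^-1 <= f k.
Proof.
move=> kk; rewrite leNgt; apply/negP => fk.
have : (k.+1 <= kappa f)%N.
  by apply: (@leq_bigmax_cond _ _ (fun k : 'I_n => k.+1)); rewrite fk orbT.
by rewrite ltnNge kk.
Qed.

Lemma card_ord_lt (k : nat) : (k <= n)%N -> #|[set i : 'I_n | (i < k)%N]%SET| = k.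
Proof.
move=> kn; rewrite cardsE -sum1_card /=.
rewrite -(big_ord_widen_cond n xpredT (fun=> 1%N) kn).
by rewrite sum1_card card_ord.
Qed.

Lemma f_i0_le i : f i0 <= f i.
Proof. by apply: f_sorted; rewrite i0E. Qed.

(** Apart from the cheapest one there are [kappa - 1] facilities, each costing less than
    [1 / (kappa - 1)]. *)
Lemma opening_cost_kappa :
  \sum_(i in [set i : 'I_n | (i < kappa f)%N]%SET) f i <= f i0 + 1.
Proof.
have [k kE fk] := kappa_attained.
rewrite (bigD1 i0)/= ?inE ?i0E ?kappa_gt0// lerD2l.
have cE : #|[set i : 'I_n | (i < kappa f)%N]%SET :\ i0| = k.
  have := cardsD1 i0 [set i : 'I_n | (i < kappa f)%N]%SET.
  by rewrite card_ord_lt ?kappa_le_n// inE i0E kappa_gt0 -kE add1n => -[].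
rewrite (eq_bigl (fun i => i \in [set i : 'I_n | (i < kappa f)%N]%SET :\ i0)); last first.
  by move=> i; rewrite !inE andbC.
have [k0|k0] := eqVneq (nat_of_ord k) 0%N.
  by move/eqP : cE; rewrite k0 cards_eq0 => /eqP ->; rewrite big_set0.
have kR : 0 < k%:R :> R by rewrite ltr0n lt0n.
apply: (@le_trans _ _ (\sum_(i in [set i : 'I_n | (i < kappa f)%N]%SET :\ i0) k%:R^-1)).
  apply: ler_sum => i; rewrite !inE -kE ltnS => /andP[_ ik].
  apply: le_trans (f_sorted ik) _; apply: ltW.
  by move: fk; rewrite (negPf k0).
by rewrite sumr_const cE -[leLHS]mulr_natl divff ?gt_eqF.
Qed.

Lemma opening_cost_ge (U : {set 'I_n}) : (0 < #|U|)%N -> f i0 <= \sum_(i in U) f i.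
Proof.
move=> /card_gt0P[u uU]; rewrite (bigD1 u)//=; apply: le_trans (f_i0_le u) _.
by rewrite lerDl sumr_ge0// => i _; exact: ltW.
Qed.

(** One facility accounts for [f i0]. At least [kappa * b] others remain, at most [kappa] of them
    among the cheapest, and each of the rest costs at least [1 / kappa]. *)
Lemma opening_cost_many (U : {set 'I_n}) (b : nat) : (kappa f < n)%N ->
  (kappa f * b < #|U|)%N -> f i0 + (b%:R - 1) <= \sum_(i in U) f i.
Proof.
move=> kn bU; have k0 := kappa_gt0.
have kR : 0 < (kappa f)%:R :> R by rewrite ltr0n.
have /card_gt0P[u uU] : (0 < #|U|)%N by exact: leq_ltn_trans bU.
rewrite (bigD1 u)//=; apply: lerD; first exact: f_i0_le.
pose L := [set i : 'I_n | (i < kappa f)%N]%SET.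
pose V := ((U :\ u) :\: L)%SET.
apply: (@le_trans _ _ (\sum_(i in V) (kappa f)%:R^-1)).
  have cV : (kappa f * b <= kappa f + #|V|)%N.
    have cI := subset_leq_card (finset.subsetIr (U :\ u)%SET L).
    rewrite card_ord_lt ?kappa_le_n// in cI.
    move: bU; rewrite (cardsD1 u U) uU add1n ltnS => /leq_trans; apply.
    by rewrite -(cardsID L (U :\ u)) leq_add2r.
  rewrite sumr_const -[leRHS]mulr_natl ler_pdivlMr// mulrBl mul1r lerBlDl mulrC -natrM.
  by rewrite -natrD ler_nat.
rewrite [leRHS](eq_bigl (fun i => i \in U :\ u)); last by move=> i; rewrite !inE andbC.
rewrite [leRHS](big_setID L)/= addrC -[leLHS]addr0; apply: lerD; last first.
  by apply: sumr_ge0 => i _; exact: ltW.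
apply: ler_sum => i; rewrite !inE -leqNgt => /andP[ki _].
by apply: le_trans (kappa_out (leqnn (Ordinal kn))) _; exact: f_sorted.
Qed.

End OpeningCosts.

(** * The expected ratio *)

Lemma measurable_fun_invr d (T : measurableType d) (R : realType) (F : T -> R) :
  measurable_fun setT F -> measurable_fun setT (fun x => (F x)^-1).
Proof.
move=> mF.
(* [1 / y = y (y^2)^(-1)] reduces the inverse to a real power with nonnegative base; at [y = 0] both
   sides are 0. *)
rewrite (_ : (fun x => _) = (fun x => F x * (F x ^+ 2) `^ (- 1))); last first.
  apply/funext => x; rewrite powR_inv1 ?sqr_ge0//.
  have [->|F0] := eqVneq (F x) 0; first by rewrite invr0 mul0r.
  by rewrite expr2 invfM mulrA divff// mul1r.
apply: measurable_funM => //.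
apply: (measurableT_comp (f := fun y : R => y `^ (- 1))).
  exact: measurable_powR.
exact: measurable_funX.
Qed.

(** Here [y] is [1 / f_1] and [F] the opening cost of ALG. The splitting level [N^(Q+5)] makes the
    second-moment term [27 / N], and [2 Q + 10] is then the exponent that brings
    [N^(Q+1) N^3 N^(Q+5)] down to [1 / N]; 29 = 1 + 1 + 27. *)
Lemma bad_event_numeric (R : realType) (Q : nat) (N y F : R) :
  1 <= N -> 0 <= y <= N ^+ Q.+1 -> y * F <= N ^+ Q.+1 ->
  y * (F * N ^- (2 * Q + 10) +
       N ^+ 3 * (N ^+ (Q + 5) * N ^- (2 * Q + 10) + 27 / N ^+ (Q + 5))) <= 29 / N.
Proof.
move=> N1 /andP[y0 yN] yF; set D := (2 * Q + 10)%N.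
have N0 : 0 < N by exact: lt_le_trans N1.
have Nn : N != 0 by rewrite gt_eqF.
have D1 : (1 + Q.+1 <= D)%N by rewrite /D; lia.
have D2 : (1 + (Q.+1 + (3 + (Q + 5))) <= D)%N by rewrite /D; lia.
have P1 : N ^+ Q.+1 * N ^- D <= N^-1.
  rewrite ler_pdivrMr ?exprn_gt0// mulrC ler_pdivlMr// mulrC -exprS.
  by rewrite ler_weXn2l.
have P2 : N ^+ Q.+1 * (N ^+ 3 * (N ^+ (Q + 5) * N ^- D)) <= N^-1.
  have -> : N ^+ Q.+1 * (N ^+ 3 * (N ^+ (Q + 5) * N ^- D)) =
      N ^+ (Q.+1 + (3 + (Q + 5))) / N ^+ D by rewrite !exprD !mulrA.
  rewrite ler_pdivrMr ?exprn_gt0// mulrC ler_pdivlMr// mulrC -exprS.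
  by rewrite ler_weXn2l.
have P3 : N ^+ Q.+1 * (N ^+ 3 * (27 / N ^+ (Q + 5))) = 27 * N^-1.
  have -> : (Q + 5 = Q.+1 + 3 + 1)%N by lia.
  by rewrite !exprD expr1; field; rewrite ?expf_neq0 ?Nn.
have A0 : 0 <= N ^+ 3 * (N ^+ (Q + 5) * N ^- D).
  by rewrite !mulr_ge0 ?invr_ge0 ?exprn_ge0 ?ltW.
have B0 : 0 <= N ^+ 3 * (27 / N ^+ (Q + 5)).
  by rewrite !mulr_ge0 ?invr_ge0 ?exprn_ge0 ?ltW.
have E1 : y * F * N ^- D <= N ^+ Q.+1 * N ^- D.
  by rewrite ler_wpM2r// invr_ge0 exprn_ge0 ?ltW.
have E2 := ler_wpM2r A0 yN; have E3 := ler_wpM2r B0 yN.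
rewrite !mulrDr [y * (F * _)]mulrA; rewrite P3 in E3.
apply: (@le_trans _ _ (N^-1 + (N^-1 + 27 * N^-1))); last by lra.
apply: lerD; first exact: le_trans P1.
by apply: lerD => //; exact: le_trans P2.
Qed.

Section Ratio.
Context {R : realType} {n : nat} d (T : measurableType d).
Variables (P : probability T R) (X : 'I_n * 'I_n -> {RV P >-> R}).
Hypothesis iidX : iid_exp1 X.
Variable f : 'I_n -> R.
Hypothesis f_gt0 : forall i, 0 < f i.
Hypothesis f_sorted : forall i j : 'I_n, (i <= j)%N -> f i <= f j.
Variable i0 : 'I_n.
Hypothesis i0E : nat_of_ord i0 = 0%N.

Local Notation Y := (pos_weight X).
Local Notation cheapest := ([set k : 'I_n | (k < kappa f)%N]%SET).

Let n_gt0 : (0 < n)%N. Proof. exact: leq_ltn_trans (ltn_ord i0). Qed.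

Let k_gt0 : (0 < kappa f)%N. Proof. exact: (kappa_gt0 f i0E). Qed.

Lemma card_cheapest : #|cheapest| = kappa f.
Proof. by rewrite card_ord_lt// (kappa_le_n f i0E). Qed.

Lemma measurable_ratio (Z : 'I_n * 'I_n -> T -> R) :
  (forall e, measurable_fun setT (Z e)) ->
  measurable_fun setT (fun x => (ALG f (Z ^~ x) / OPT f (Z ^~ x))%:E).
Proof.
move=> mZ; apply/measurable_EFinP; apply: measurable_funM.
  by apply: (measurable_flcost mZ); rewrite card_cheapest.
by apply: measurable_fun_invr; exact: measurable_OPT.
Qed.

Lemma integral_ratio_pos :
  (\int[P]_x (ALG f (fun e => X e x) / OPT f (fun e => X e x))%:E =
   \int[P]_x (ALG f (Y ^~ x) / OPT f (Y ^~ x))%:E)%E.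
Proof.
apply: ae_eq_integral => //.
- exact: measurable_ratio.
- by apply: measurable_ratio => e; exact: measurable_pos_weight.
- apply: filterS (ae_pos_weight iidX) => x Hx _; congr (_ / _)%:E.
    exact: eq_flcost.
  exact: eq_OPT.
Qed.

Lemma OPT_ge_f0 x : f i0 <= OPT f (Y ^~ x).
Proof.
have [U U0 ->] := OPT_attained f (Y ^~ x) n_gt0.
rewrite flcostE -[leLHS]addr0; apply: lerD.
  exact: (opening_cost_ge f_gt0 f_sorted i0E).
by apply: conn_cost_ge0 => // e; exact: pos_weight_ge0.
Qed.

Lemma ratio_ge1 x : 1 <= ALG f (Y ^~ x) / OPT f (Y ^~ x).
Proof.
rewrite ler_pdivlMr ?mul1r; last exact: lt_le_trans (OPT_ge_f0 x).
by apply: OPT_le; rewrite card_cheapest.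
Qed.

Lemma OPT_ge_expensive x (b : nat) tau : (kappa f < n)%N ->
  (kappa f * b <= n)%N -> tau <= b%:R - 1 ->
  ~ cheap_set X (kappa f * b) tau x -> f i0 + tau <= OPT f (Y ^~ x).
Proof.
move=> kn bn tb xA; have [U U0 ->] := OPT_attained f (Y ^~ x) n_gt0.
rewrite flcostE; have [Ub|Ub] := leqP #|U| (kappa f * b).
  apply: lerD; first exact: (opening_cost_ge f_gt0 f_sorted i0E).
  by apply/ltW/(notin_cheap_set bn xA); rewrite U0.
have H := opening_cost_many f_gt0 f_sorted i0E kn Ub.
have : 0 <= conn_cost (Y ^~ x) U.
  by apply: conn_cost_ge0 => // e; exact: pos_weight_ge0.
by move: H; set F := \sum_(_ in _) _; lra.
Qed.

Local Notation F := (\sum_(i in cheapest) f i).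
Local Notation C x := (conn_cost (Y ^~ x) cheapest).

(** The main term is integrated over the whole space, so only the mean of the cost enters; the
    weaker bound [OPT >= f i0] is added on the exceptional event alone. *)
Lemma integral_ratio_le (b : nat) tau a p : (kappa f < n)%N -> (0 < b)%N ->
  (kappa f * b <= n)%N -> 0 <= tau -> tau <= b%:R - 1 -> 0 < a ->
  (P (cheap_set X (kappa f * b) tau) <= p%:E)%E ->
  (\int[P]_x (ALG f (Y ^~ x) / OPT f (Y ^~ x))%:E <=
   ((f i0 + tau)^-1 * (F + \sum_(kappa f <= i < n) i%:R^-1) +
    (f i0)^-1 * (F * p + n%:R ^+ 3 * (a * p + 27 / a)))%:E)%E.
Proof.
move=> kn b0 bn tau0 tb a0 PA; set A := cheap_set _ _ _ in PA.
have mA : measurable A by apply: measurable_cheap_set; rewrite muln_gt0 k_gt0.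
have c0 : (0 < #|cheapest|)%N by rewrite card_cheapest.
have mY := measurable_pos_weight X.
have mC := measurable_conn_cost mY c0.
have C0 x : 0 <= C x by apply: conn_cost_ge0 => // e; exact: pos_weight_ge0.
have F0 : 0 <= F by apply: sumr_ge0 => i _; exact: ltW.
have f0 := f_gt0 i0.
have W0 : 0 < f i0 + tau by rewrite ltr_wpDr.
have mCF : measurable_fun setT (fun x => C x + F) by exact: measurable_funD.
have CF0 x : 0 <= C x + F by rewrite addr_ge0.
have mCFE k D : measurable_fun D (fun x => (k * (C x + F))%:E).
  by apply: measurable_funTS; apply/measurable_EFinP; exact: measurable_funM.
apply: (@le_trans _ _ (\int[P]_x (((f i0 + tau)^-1 * (C x + F))%:E +
    ((fun x => ((f i0)^-1 * (C x + F))%:E) \_ A) x))%E).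
  apply: ge0_le_integral => //.
  - by move=> x _; rewrite lee_fin (le_trans _ (ratio_ge1 x)).
  - exact: measurable_ratio.
  - apply: emeasurable_funD => //.
    by apply/(measurable_restrictT _ _).1.
  move=> x _; rewrite patchE; case: ifPn => xA.
    rewrite -EFinD lee_fin; apply: (@le_trans _ _ ((f i0)^-1 * (C x + F))); last first.
      by rewrite lerDr mulr_ge0// invr_ge0 ltW.
    rewrite mulrC /ALG flcostE addrC ler_wpM2r//.
    by rewrite lef_pV2 ?posrE ?(lt_le_trans f0) ?OPT_ge_f0.
  rewrite adde0 lee_fin mulrC /ALG flcostE addrC ler_wpM2r//.
  have H : f i0 + tau <= OPT f (Y ^~ x).
    by apply: (OPT_ge_expensive kn bn tb); move: xA; rewrite notin_setE.
  by rewrite lef_pV2 ?posrE// (lt_le_trans f0) ?OPT_ge_f0.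
rewrite ge0_integralD//; last 3 first.
- by move=> x _; rewrite lee_fin mulr_ge0// invr_ge0 ltW.
- move=> x _; apply: erestrict_ge0 => y _.
  by rewrite lee_fin mulr_ge0// invr_ge0 ltW.
- by apply/(measurable_restrictT _ _).1.
rewrite -integral_mkcond EFinD; apply: leeD.
  under eq_integral do rewrite EFinM.
  rewrite ge0_integralZl_EFin//; last 3 first.
  - by move=> x _; rewrite lee_fin.
  - exact/measurable_EFinP.
  - by rewrite invr_ge0 ltW.
  rewrite EFinM lee_pmul2l ?lte_fin ?invr_gt0// addrC EFinD.
  rewrite ge0_integralDcst//; apply: leeD2r.
  rewrite -[X in \sum_(X <= _ < _) _]card_cheapest.
  exact: (mean_conn_cost mY (pos_weight_ge0 X)
    (pos_weight_nonedge X) (pos_weight_ray iidX)).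
under eq_integral do rewrite EFinM.
rewrite ge0_integralZl_EFin//; last 3 first.
- by move=> x _; rewrite lee_fin.
- by apply: measurable_funTS; exact/measurable_EFinP.
- by rewrite invr_ge0 ltW.
rewrite EFinM lee_pmul2l ?lte_fin ?invr_gt0//.
under eq_integral do rewrite EFinD.
rewrite ge0_integralD//; last 2 first.
- by move=> x _; rewrite lee_fin.
- by apply: measurable_funTS; exact/measurable_EFinP.
rewrite [X in (_ <= X%:E)%E]addrC EFinD; apply: leeD.
  exact: (integral_conn_cost_restr mY (pos_weight_ge0 X)
    (pos_weight_nonedge X) (pos_weight_ray iidX)).
rewrite [leLHS](integral_cst P mA F%:E) EFinM.
by apply: lee_wpmul2l => //; rewrite lee_fin.
Qed.

Lemma integral_ratio_le_explicit (Q s : nat) (eps : R) :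
  let l := ln (n%:R / (kappa f)%:R) in
  (forall i, f i <= n%:R ^+ Q * f i0) ->
  0 < eps < 1 -> (2 * kappa f <= n)%N -> 1 <= l ->
  2 * ((2 * Q + 10)%:R + 2) <= s%:R * eps ->
  48 * s.+1%:R <= eps ^+ 2 * l ->
  (\int[P]_x (ALG f (Y ^~ x) / OPT f (Y ^~ x))%:E <=
   ((2 + l) / ((1 - eps) * l) + 29 / n%:R)%:E)%E.
Proof.
move=> l fQ /andP[e0 e1] kn l1 seps lbig.
have kn' : (kappa f < n)%N by move: k_gt0 kn; lia.
(* An integer with [b - 1 >= l >= tau], so that larger sets already pay [tau] for opening. *)
pose b := (Num.truncn (1 + l)).+1; pose D := (2 * Q + 10)%N.
have /andP[bl bu] : 1 + l <= b%:R <= 2 + l.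
  have /truncn_itv /andP[t1 t2] : 0 <= 1 + l by lra.
  by rewrite /b (ltW t2) /= -natr1; lra.
pose tau := (1 - eps) * l; pose N : R := n%:R.
have tau0 : 0 < tau by rewrite mulr_gt0//; lra.
have taul : tau <= l by rewrite /tau ler_piMl//; lra.
have tb : tau <= b%:R - 1 by lra.
have N1 : 1 <= N by rewrite ler1n.
have N0 : 0 < N by lra.
have Nn : N != 0 by rewrite gt_eqF.
have [bn PA] : (kappa f * b <= n)%N /\ _ := union_bound_numeric (D := D)
  (introT andP (conj e0 (ltW e1))) k_gt0 kn l1 seps (introT andP (conj bl bu)) lbig.
have PA' : (P (cheap_set X (kappa f * b) tau) <= (N ^- D)%:E)%E.
  apply: le_trans (prob_cheap_set iidX s tau _ bn) _; last by rewrite lee_fin.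
  by rewrite muln_gt0 k_gt0.
clear PA.
apply: le_trans (integral_ratio_le kn' (ltn0Sn _) bn (ltW tau0) tb
  (exprn_gt0 (Q + 5) N0) PA') _.
rewrite lee_fin; apply: lerD.
  have f0 := f_gt0 i0.
  have W0 : 0 < f i0 + tau by rewrite addr_gt0.
  (* As [tau <= 2 + l], adding [f i0] to numerator and denominator of [(2 + l) / tau] can only
     decrease it. *)
  rewrite mulrC ler_pdivrMr// mulrAC ler_pdivlMr//.
  have HF := opening_cost_kappa f_sorted i0E.
  have HS := sum_inv_le_ln (R := R) k_gt0 kn'; rewrite -/l in HS.
  apply: (@le_trans _ _ ((f i0 + 1 + (1 + l)) * tau)).
    by rewrite ler_wpM2r ?(ltW tau0)// lerD.
  have H : tau * f i0 <= (2 + l) * f i0 by rewrite ler_pM2r//; lra.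
  by rewrite -/tau; move: H; move: (tau) (f i0) => t y; lra.
have f0 := f_gt0 i0.
pose last_i := Ordinal (ltac:(by rewrite ltn_predL) : (n.-1 < n)%N).
(* The dearest facility lies beyond [kappa], hence costs at least [1 / (n - 1)]; the bound on cost
   ratios carries this over to [f i0]. *)
have inv_f0 : (f i0)^-1 <= N ^+ Q.+1.
  have fl : N^-1 <= f last_i.
    apply: le_trans (kappa_out (f := f) (k := last_i) _); last first.
      by rewrite /= -ltnS prednK.
    have p0 : (0 < n.-1)%N by rewrite -ltnS prednK// (leq_ltn_trans k_gt0).
    by rewrite lef_pV2 ?posrE ?ltr0n//= ler_nat leq_pred.
  rewrite -[leLHS]mul1r ler_pdivrMr// exprS -mulrA -ler_pdivrMl// mulr1.
  exact: le_trans fl (fQ last_i).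
have HF : (f i0)^-1 * F <= N ^+ Q.+1.
  rewrite mulrC ler_pdivrMr//.
  apply: (@le_trans _ _ (\sum_(i in cheapest) (N ^+ Q * f i0))).
    by apply: ler_sum => i _; exact: fQ.
  rewrite sumr_const card_cheapest -[leLHS]mulr_natl exprS mulrA.
  apply: ler_wpM2r; first exact: ltW.
  apply: ler_wpM2r; first by rewrite exprn_ge0// ltW.
  by rewrite ler_nat ltnW.
by apply: bad_event_numeric => //; rewrite inv_f0 invr_ge0 ltW.
Qed.

End Ratio.

Lemma main_term_numeric (R : realType) (e l : R) : 0 < e <= 1 -> 8 <= l * e ->
  (2 + l) / ((1 - e / 8) * l) <= 1 + e / 2.
Proof.
move=> /andP[e0 e1] l8; have l0 : 0 < l by nra.
rewrite ler_pdivrMr; last by rewrite mulr_gt0//; lra.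
have H : e * e * l <= 1 * e * l by rewrite ler_pM2r// ler_pM2r.
lra.
Qed.

Unset Implicit Arguments. Set Strict Implicit.

Theorem theorem1 (R : realType) (f : forall n : nat, 'I_n -> R)
  (f_pos : forall (n : nat) (i : 'I_n), 0 < f n i)
  (f_sorted : forall (n : nat) (i j : 'I_n), (i <= j)%N -> f n i <= f n j)
  (f_ratio : exists q : R, forall (n : nat) (i j : 'I_n),
      nat_of_ord i = 0%N -> nat_of_ord j = n.-1 -> f n j / f n i <= n%:R `^ q)
  (kappa_small : (fun n : nat => (kappa (f n))%:R / n%:R : R) @ \oo --> 0) :
  forall eps : R, 0 < eps -> exists N : nat, forall n : nat, (N <= n)%N ->
    forall (d : measure_display) (T : measurableType d) (P : probability T R)
      (X : 'I_n * 'I_n -> {RV P >-> R}),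
    iid_exp1 X ->
    ((1 - eps)%:E <= \int[P]_x (ALG (f n) (fun e => X e x)
                                / OPT (f n) (fun e => X e x))%:E
     <= (1 + eps)%:E)%E.
Proof.
move=> eps eps0; have [q fq] := f_ratio.
have [Q qQ] : exists Q : nat, q <= Q%:R.
  exists (Num.truncn `|q|).+1.
  by apply: le_trans (ler_norm q) _; rewrite ltW// truncnS_gt.
have [eps1 [e10 e11 e1e]] : exists e : R, [/\ 0 < e, e <= 1 & e <= eps].
  by exists (Order.min eps 1); rewrite lt_min eps0 ltr01 !ge_min !lexx orbT.
have e0 : 0 < eps1 / 8 by lra.
have e1 : eps1 / 8 < 1 by lra.
have [s seps] : exists s : nat,
    2 * ((2 * Q + 10)%:R + 2) <= s%:R * (eps1 / 8).
  exists (Num.truncn (2 * ((2 * Q + 10)%:R + 2) / (eps1 / 8))).+1.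
  by rewrite -ler_pdivrMr// ltW// truncnS_gt.
(* [s] and [l0] depend only on [eps] and [q], so the final threshold is uniform over all probability
   spaces. *)
have [l0 [l01 l0s l0e]] : exists l0 : R,
    [/\ 1 <= l0, 48 * s.+1%:R <= (eps1 / 8) ^+ 2 * l0 & 8 <= l0 * eps1].
  exists (Order.max 1 (Order.max (48 * s.+1%:R / (eps1 / 8) ^+ 2) (8 / eps1))).
  split; first by rewrite le_max lexx.
    by rewrite [leRHS]mulrC -ler_pdivrMr ?exprn_gt0// !le_max lexx orbT.
  by rewrite -ler_pdivrMr// !le_max lexx !orbT.
(* [kappa / n < 1/2] gives [2 kappa <= n], and [kappa / n < exp (- l0)] gives [l >= l0]. *)
have delta0 : 0 < Order.min (2^-1) (expR (- l0)).
  by rewrite lt_min invr_gt0 ltr0n expR_gt0.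
have /cvgr0Pnorm_lt /(_ _ delta0) [N1 _ HN1] := kappa_small.
(* Makes the exceptional term [29 / n] at most [eps1 / 2]. *)
have [N2 HN2] : exists N2 : nat, 58 / eps1 < N2%:R.
  by exists (Num.truncn (58 / eps1)).+1; rewrite truncnS_gt.
exists (maxn N1 N2) => n; rewrite geq_max => /andP[N1n N2n] d T P X iidX.
have n58 : 58 / eps1 < n%:R by apply: lt_le_trans HN2 _; rewrite ler_nat.
have nR : 0 < n%:R :> R by apply: lt_trans n58; rewrite divr_gt0.
have n0 : (0 < n)%N by rewrite -(ltr0n R).
have n29 : 29 / n%:R <= eps1 / 2.
  move: n58; rewrite ltr_pdivrMr// ler_pdivrMr//; lra.
pose i0 := Ordinal n0; have i0E : nat_of_ord i0 = 0%N by [].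
have k0 := kappa_gt0 (f n) i0E.
have kR : 0 < (kappa (f n))%:R :> R by rewrite ltr0n.
have := HN1 n N1n; rewrite /= ger0_norm ?divr_ge0// lt_min => /andP[k2 kl].
have kn : (2 * kappa (f n) <= n)%N.
  by move: k2; rewrite ltr_pdivrMr// -(ler_nat R) natrM; lra.
pose l := ln (n%:R / (kappa (f n))%:R : R).
have ll0 : l0 <= l.
  rewrite -ler_expR lnK ?posrE ?divr_gt0// -[leLHS]invrK -expRN.
  by rewrite -[leRHS]invf_div lef_pV2 ?posrE ?divr_gt0 ?expR_gt0// ltW.
have fQ i : f n i <= n%:R ^+ Q * f n i0.
  have nl : (n.-1 < n)%N by rewrite ltn_predL.
  apply: (@le_trans _ _ (f n (Ordinal nl))).
    by apply: f_sorted => /=; rewrite -ltnS prednK.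
  rewrite -ler_pdivrMr//; apply: le_trans (fq n i0 (Ordinal nl) _ _) _ => //.
  by rewrite -powR_mulrn//; apply: ler_powR; rewrite ?ler1n.
rewrite (integral_ratio_pos iidX (f n) i0E); apply/andP; split.
  apply: (@le_trans _ _ (\int[P]_x 1)%E).
    by rewrite integral_cst_prob lee_fin gerBl ltW.
  apply: ge0_le_integral => //.
    by apply: (measurable_ratio (f n) i0E) => e'; exact: measurable_pos_weight.
  by move=> x _; rewrite lee_fin; exact: (ratio_ge1 X (f_pos n) (@f_sorted n) i0E).
apply: le_trans (integral_ratio_le_explicit iidX (f_pos n) (@f_sorted n) i0E
  fQ (introT andP (conj e0 e1)) kn _ seps _) _; rewrite -/l.
- exact: le_trans ll0.
- by apply: le_trans l0s _; rewrite ler_pM2l ?exprn_gt0.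
rewrite lee_fin; apply: (@le_trans _ _ (1 + eps1)); last by rewrite lerD2l.
have l8 : 8 <= l * eps1 by apply: le_trans l0e _; rewrite ler_pM2r.
have := main_term_numeric (introT andP (conj e10 e11)) l8.
move: n29; move: (_ / n%:R) (_ / (_ * l)) => x y; lra.
Qed.
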